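(* Let $k$ be a field of characteristic zero and $d,e\ge0$ integers. Let $\mathrm{Corr}_{d,e}^{ss}$ and $\mathrm{Corr}_{d,e}^{s}$ denote the semistable and stable loci of $\mathrm{Corr}_{d,e}$ for the conjugation action of $\mathrm{SL}_2$. Then $\mathrm{Corr}_{d,e}^{ss}=\mathrm{Corr}_{d,e}^{s}$ if and only if $d+e$ is odd.
   Context: $V_{d,e}$ denotes the $k$-vector space of forms $f=\sum_{0\le i\le d,\,0\le j\le e}a_{ij}x_0^{d-i}x_1^{i}y_0^{e-j}y_1^{j}$, i.e. the global sections of $\mathcal{O}(d,e)$ on $\mathbb{P}^1\times\mathbb{P}^1$. $\mathrm{Corr}_{d,e}:=\mathbb{P}(V_{d,e})\cong\mathbb{P}^{(d+1)(e+1)-1}$ is the space of lines in $V_{d,e}$, parameterizing the closed subschemes $V(f)\subset\mathbb{P}^1\times\mathbb{P}^1$. The conjugation action is the action of $\mathrm{SL}_2$ (through $\mathrm{PGL}_2=\mathrm{Aut}(\mathbb{P}^1)$) on $\mathrm{Corr}_{d,e}$ induced by the diagonal action on $\mathbb{P}^1\times\mathbb{P}^1$; it comes from the linear action on $V_{d,e}$ by simultaneous substitution of the same linear change of variables in $(x_0,x_1)$ and $(y_0,y_1)$, which gives an $\mathrm{SL}_2$-linearization of $\mathcal{O}(1)$. Stability is in the sense of geometric invariant theory with respect to this linearization: with $X=\mathrm{Corr}_{d,e}$, $G=\mathrm{SL}_2$, a geometric point $P$ is semistable if there are $n\ge1$ and $s\in H^0(X,\mathcal{O}(n))^{G}$ with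 $s(P)\ne0$ (then $X_s=\{s\neq0\}$ is affine); it is stable (Mumford's ''properly stable'') if moreover $P$ has finite stabilizer and $s$ can be chosen so that all $G$-orbits in $X_s$ are closed in $X_s$. The loci are the open subschemes whose geometric points are the semistable (resp. stable) ones. *)

(* Defs.v *)
From HB Require Import structures.
From mathcomp Require Import all_boot all_order all_algebra.
From mathcomp Require Import mpoly.

Set Implicit Arguments.
Unset Strict Implicit.
Unset Printing Implicit Defensive.

Import GRing.Theory.
Local Open Scope ring_scope.

(* The variables are ordered x_0, x_1, y_0, y_1, i.e. indexed by 'I_(2 + 2). *)
Definition xvar (R : comNzRingType) (i : 'I_2) : {mpoly R[2 + 2]} :=
  'X_(lshift 2 i).
Definition yvar (R : comNzRingType) (i : 'I_2) : {mpoly R[2 + 2]} :=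
  'X_(rshift 2 i).

(* The exponent of x_0^(d-i) x_1^i y_0^(e-j) y_1^j. *)
Definition bimon (d e : nat) (i : 'I_d.+1) (j : 'I_e.+1) : 'X_{1..2 + 2} :=
  (U_(lshift 2 ord0) *+ (d - i) + U_(lshift 2 ord_max) *+ i
   + U_(rshift 2 ord0) *+ (e - j) + U_(rshift 2 ord_max) *+ j)%MM.

(* An element of V_{d,e} (with coefficients in R) is represented by its
   coefficient matrix (a_ij). *)
Definition biform (R : comNzRingType) (d e : nat) (A : 'M[R]_(d.+1, e.+1)) :
    {mpoly R[2 + 2]} :=
  \sum_(i < d.+1) \sum_(j < e.+1) A i j *: 'X_[bimon i j].

Definition lin_subst (R : comNzRingType) (g : 'M[R]_2) :
    (2 + 2).-tuple {mpoly R[2 + 2]} :=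
  [tuple match split u with
         | inl i => \sum_(l < 2) g i l *: xvar R l
         | inr i => \sum_(l < 2) g i l *: yvar R l
         end | u < 2 + 2].

(* The coefficient matrix of f o g; the substitution preserves the bidegree, so
   no coefficient is lost. This is a right action; composing it with
   g |-> g^-1 turns it into the left action without changing the orbits, the
   stabilizers or the invariants. *)
Definition conj_act (R : comNzRingType) (d e : nat) (g : 'M[R]_2)
    (A : 'M[R]_(d.+1, e.+1)) : 'M[R]_(d.+1, e.+1) :=
  \matrix_(i, j) (biform A \mPo lin_subst g)@_(bimon i j).

Definition SL2 (R : comNzRingType) (g : 'M[R]_2) : Prop := \det g = 1.

(* Homogeneous coordinates on Corr_{d,e}: polynomials in the a_ij. *)
Notation coord_ring R d e := {mpoly R[d.+1 * e.+1]}.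

Definition section_value (k R : comNzRingType) (phi : {rmorphism k -> R})
    (d e : nat) (s : coord_ring k d e) (A : 'M[R]_(d.+1, e.+1)) : R :=
  (map_mpoly phi s).@[mxvec A 0].

(* Invariance under the group scheme SL_2 over k, i.e. under its R-points for
   every commutative k-algebra R. *)
Definition SL2_invariant (k : fieldType) (d e : nat) (s : coord_ring k d e) :
    Prop :=
  forall (R : comNzRingType) (phi : {rmorphism k -> R}) (g : 'M[R]_2)
    (A : 'M[R]_(d.+1, e.+1)),
    SL2 g -> section_value phi s (conj_act g A) = section_value phi s A.

(* s is an invariant global section of O(n) over k. *)
Definition invariant_section (k : fieldType) (d e n : nat)
    (s : coord_ring k d e) : Prop :=
  s \is n.-homog /\ SL2_invariant s.

(* From here on, a K-point of Corr_{d,e} is a nonzero coefficient matrix over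
   K, taken up to a nonzero scalar. *)

Definition same_orbit (K : fieldType) (d e : nat)
    (A B : 'M[K]_(d.+1, e.+1)) : Prop :=
  exists (g : 'M[K]_2) (c : K), [/\ SL2 g, c != 0 & B = c *: conj_act g A].

Definition in_stabilizer (K : fieldType) (d e : nat)
    (A : 'M[K]_(d.+1, e.+1)) (g : 'M[K]_2) : Prop :=
  SL2 g /\ exists2 c : K, c != 0 & conj_act g A = c *: A.

Definition finite_stabilizer (K : fieldType) (d e : nat)
    (A : 'M[K]_(d.+1, e.+1)) : Prop :=
  exists gs : seq 'M[K]_2, forall g, in_stabilizer A g -> g \in gs.

(* The set of K-points S is closed in the set of K-points U for the Zariski
   topology of the projective space Corr_{d,e}. *)
Definition zariski_closed_in (K : fieldType) (d e : nat)
    (U S : 'M[K]_(d.+1, e.+1) -> Prop) : Prop :=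
  exists Z : coord_ring K d e -> Prop,
    (forall F, Z F -> exists m : nat, F \is m.-homog) /\
    (forall B, B != 0 -> U B ->
       (S B <-> forall F, Z F -> F.@[mxvec B 0] = 0)).

Definition orbits_closed (k : fieldType) (d e : nat) (s : coord_ring k d e) :
    Prop :=
  forall (L : closedFieldType) (phi : {rmorphism k -> L})
    (Q : 'M[L]_(d.+1, e.+1)),
    Q != 0 -> section_value phi s Q != 0 ->
    zariski_closed_in (fun B => section_value phi s B != 0) (same_orbit Q).

Definition semistable (k : fieldType) (K : closedFieldType)
    (iota : {rmorphism k -> K}) (d e : nat) (P : 'M[K]_(d.+1, e.+1)) : Prop :=
  exists (n : nat) (s : coord_ring k d e),
    [/\ (1 <= n)%N, invariant_section n s & section_value iota s P != 0].

(* Mumford's "properly stable". In characteristic zero the stabilizer is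
   reduced, so it is finite iff it has finitely many K-points. *)
Definition stable (k : fieldType) (K : closedFieldType)
    (iota : {rmorphism k -> K}) (d e : nat) (P : 'M[K]_(d.+1, e.+1)) : Prop :=
  finite_stabilizer P /\
  exists (n : nat) (s : coord_ring k d e),
    [/\ (1 <= n)%N, invariant_section n s, section_value iota s P != 0
      & orbits_closed s].

(* Open subschemes of Corr_{d,e} are compared through their geometric points,
   with values in any algebraically closed extension K of k. *)
Definition loci_coincide (k : fieldType) (d e : nat) : Prop :=
  forall (K : closedFieldType) (iota : {rmorphism k -> K})
    (P : 'M[K]_(d.+1, e.+1)),
    P != 0 -> (semistable iota P <-> stable iota P).

(* Main.v *)
(** The conjugation action on coefficient matrices is A |-> S_d(g)^T A S_e(g), where S_d(g) is the
matrix of g on the d-th symmetric power; a torus element scales the (i,j) entry by t^(2(i+j)-(d+e)).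

If d + e is odd, no weight vanishes. Let s be a homogeneous invariant with s(f) != 0. A form whose
entries with 2(i+j) < d+e vanish has s = 0, so the polynomials z |-> (f o [1,0;z,1])_ij with
2(i+j) < d+e have no common zero and generate the unit ideal. Now let u be the first column of g in
SL_2 and w = (0,1). Then (f o [u,w])_ij = ((f o g) o [1,-g01;0,g00])_ij, which for fixed f o g has
degree only i+j < (d+e)/2 in the entries of g. Hence homogenizing the Bezout identity expresses a
power of g00 through the coordinates of f o g and lower degree monomials in g. The same holds for
the other entries, so the entries of g are integral over the coordinates of f o g: the orbit map is
finite. Therefore stabilizers are finite, and orbits are closed in {s != 0} because points of the
closure lift along integral extensions.

If d + e = 2m, the apolar quadratic form is an invariant that does not vanish on the form with all
coefficients of weight zero equal to 1, and this form is fixed by the torus. This needs an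
algebraically closed extension of k, obtained as an ultraproduct of algebraic closures of the
finitely generated subfields of k. *)

Require Import Defs.
From HB Require Import structures.
From mathcomp Require Import all_boot all_order all_algebra closed_field.
From mathcomp Require Import mpoly ring zify.
From mathcomp Require boolp filter.

Set Implicit Arguments.
Unset Strict Implicit.
Unset Printing Implicit Defensive.

Import GRing.Theory.
Local Open Scope ring_scope.

(** * Symmetric powers of two by two matrices and the conjugation action *)

Section SymmetricPower.
Variable R : comNzRingType.
Implicit Types (g h : 'M[R]_2) (d : nat) (P : {poly R}).

(** The linear form a x_0 + b x_1, dehomogenized by x_0 = 1. *)
Definition linpoly (a b : R) : {poly R} := a%:P + b *: 'X.

Definition sym_poly d g (i : nat) : {poly R} :=
  linpoly (g 0 0) (g 0 1) ^+ (d - i) * linpoly (g 1 0) (g 1 1) ^+ i.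

Definition sym_mx d g : 'M[R]_d.+1 := \matrix_(i, j) (sym_poly d g i)`_j.

(** The degree is an argument, since a form of degree [d] may dehomogenize to a polynomial of
    smaller degree. *)
Definition homogenize d P (x y : R) := \sum_(i < d.+1) P`_i * x ^+ (d - i) * y ^+ i.

Lemma coef_mul_linpoly P a b i :
  (P * linpoly a b)`_i = a * P`_i + b * (if i is j.+1 then P`_j else 0).
Proof.
by rewrite /linpoly mulrDr coefD coefMC -scalerAr coefZ coefMX mulrC; case: i.
Qed.

Lemma homogenize_mul_linpoly d P a b x y : (size P <= d.+1)%N ->
  homogenize d.+1 (P * linpoly a b) x y = homogenize d P x y * (a * x + b * y).
Proof.
move=> sP; rewrite /homogenize.
under eq_bigr do rewrite coef_mul_linpoly !mulrDl.
rewrite big_split /= mulrDr !mulr_suml; congr (_ + _).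
  rewrite big_ord_recr /= (nth_default _ sP) mulr0 !mul0r addr0.
  by apply: eq_bigr => i _; rewrite subSn ?leq_ord// exprS; ring.
rewrite big_ord_recl /= mulr0 !mul0r add0r.
by apply: eq_bigr => i _; rewrite /= /bump /= subSS exprS; ring.
Qed.

Lemma size_linpoly a b : (size (linpoly a b) <= 2)%N.
Proof.
rewrite /linpoly (leq_trans (size_polyD _ _))// geq_max (leq_trans (size_polyC_leq1 _))//=.
by rewrite (leq_trans (size_scale_leq _ _))// size_polyX.
Qed.

Lemma size_mul_linpoly_exp P a b d n : (size P <= d.+1)%N ->
  (size (P * linpoly a b ^+ n)%R <= (d + n).+1)%N.
Proof.
move=> sP; elim: n => [|n IHn]; first by rewrite mulr1 addn0.
rewrite exprSr mulrA (leq_trans (size_polyMleq _ _))//.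
by have := size_linpoly a b; lia.
Qed.

Lemma size_linpoly_exp a b n : (size (linpoly a b ^+ n)%R <= n.+1)%N.
Proof.
by have := @size_mul_linpoly_exp 1 a b 0 n; rewrite mul1r add0n size_poly1; apply.
Qed.

Lemma homogenize_mul_linpoly_exp d n P a b x y : (size P <= d.+1)%N ->
  homogenize (d + n) (P * linpoly a b ^+ n) x y =
  homogenize d P x y * (a * x + b * y) ^+ n.
Proof.
move=> sP; elim: n => [|n IHn]; first by rewrite mulr1 addn0 mulr1.
by rewrite addnS !exprSr mulrA homogenize_mul_linpoly ?size_mul_linpoly_exp// IHn mulrA.
Qed.

Lemma homogenize_linpoly_exp n a b x y :
  homogenize n (linpoly a b ^+ n) x y = (a * x + b * y) ^+ n.
Proof.
have := @homogenize_mul_linpoly_exp 0 n 1 a b x y.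
by rewrite mul1r add0n size_poly1 {2}/homogenize big_ord1 coef1 !mul1r; apply.
Qed.

Lemma homogenize_sym_poly d g i x y : (i <= d)%N ->
  homogenize d (sym_poly d g i) x y =
  (g 0 0 * x + g 0 1 * y) ^+ (d - i) * (g 1 0 * x + g 1 1 * y) ^+ i.
Proof.
move=> le_id; rewrite -(homogenize_linpoly_exp (d - i)).
by rewrite -homogenize_mul_linpoly_exp ?size_linpoly_exp ?subnK.
Qed.

End SymmetricPower.

Lemma map_linpoly (R S : comNzRingType) (f : {rmorphism R -> S}) (a b : R) :
  map_poly f (linpoly a b) = linpoly (f a) (f b).
Proof. by rewrite /linpoly rmorphD /= map_polyC /= map_polyZ map_polyX. Qed.

Lemma map_sym_poly (R S : comNzRingType) (f : {rmorphism R -> S}) d g i :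
  map_poly f (sym_poly d g i) = sym_poly d (map_mx f g) i.
Proof. by rewrite /sym_poly rmorphM !rmorphXn /= !map_linpoly !mxE. Qed.

Lemma map_sym_mx (R S : comNzRingType) (f : {rmorphism R -> S}) d g :
  map_mx f (sym_mx d g) = sym_mx d (map_mx f g).
Proof. by apply/matrixP => i j; rewrite !mxE -map_sym_poly coef_map. Qed.

Lemma sum_ord2 (V : nmodType) (F : 'I_2 -> V) : \sum_(i < 2) F i = F 0 + F 1.
Proof. by rewrite big_ord_recl big_ord1; congr (_ + F _); apply: val_inj. Qed.

Lemma homogenizeE (R : comNzRingType) d (P : {poly R}) x y :
  homogenize d P x y = \sum_(i < d.+1) P`_i * x ^+ (d - i) * y ^+ i.
Proof. by []. Qed.

Lemma sym_mxM (R : comNzRingType) d (g h : 'M[R]_2) :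
  sym_mx d (g *m h) = sym_mx d g *m sym_mx d h.
Proof.
apply/matrixP => i j; rewrite !mxE.
have gh k : linpoly ((g *m h) k 0) ((g *m h) k 1) =
    (g k 0)%:P * linpoly (h 0 0) (h 0 1) + (g k 1)%:P * linpoly (h 1 0) (h 1 1).
  by rewrite /linpoly !mxE !sum_ord2 -!mul_polyC !polyCD !polyCM; ring.
rewrite {1}/sym_poly !gh.
(* Composition substitutes the rows of [h], so the identity is used over [{poly R}] with these
   linear forms as x and y. *)
have := homogenize_sym_poly (map_mx polyC g)
  (linpoly (h 0 0) (h 0 1)) (linpoly (h 1 0) (h 1 1)) (leq_ord i).
rewrite !mxE => <-; rewrite homogenizeE coef_sum; apply: eq_bigr => l _.
by rewrite -map_sym_poly coef_map /= -mulrA coefCM !mxE.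
Qed.


(** * The conjugation action as a product of matrices *)

Section ConjAct.
Variable R : comNzRingType.
Implicit Types (d e : nat) (g h : 'M[R]_2).

Lemma lshift_neq_rshift (m n : nat) (i : 'I_m) (j : 'I_n) : lshift n i == rshift m j = false.
Proof. by apply/negP => /eqP/(congr1 val)/= h; have := ltn_ord i; rewrite h; lia. Qed.

Lemma bimonE d e (i : 'I_d.+1) (j : 'I_e.+1) :
  [/\ bimon i j (lshift 2 0) = (d - i)%N, bimon i j (lshift 2 1) = i :> nat,
      bimon i j (rshift 2 0) = (e - j)%N & bimon i j (rshift 2 1) = j :> nat].
Proof.
have -> : 1 = ord_max :> 'I_2 by apply/val_inj.
rewrite /bimon !mnmDE !mulmnE !mnmE !eqxx.
rewrite !(eq_lshift, eq_rshift, lshift_neq_rshift).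
rewrite ![rshift _ _ == lshift _ _]eq_sym !lshift_neq_rshift /=.
by rewrite !mul0n !mul1n !addn0 !add0n.
Qed.

Lemma bimon_inj d e (i i' : 'I_d.+1) (j j' : 'I_e.+1) :
  (bimon i j == bimon i' j') = (i == i') && (j == j').
Proof.
apply/eqP/andP => [E|[/eqP-> /eqP->]//].
have [_ hi _ hj] := bimonE i j; have [_ hi' _ hj'] := bimonE i' j'.
by split; apply/eqP/val_inj; rewrite /= -?hi -?hj E ?hi' ?hj'.
Qed.

Lemma prod_ord2 (S : comNzRingType) (F : 'I_2 -> S) : \prod_(i < 2) F i = F 0 * F 1.
Proof. by rewrite big_ord_recl big_ord1; congr (_ * F _); apply: val_inj. Qed.

Lemma prod_ord22 (S : comNzRingType) (F : 'I_(2 + 2) -> S) :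
  \prod_(i < 2 + 2) F i =
  F (lshift 2 0) * F (lshift 2 1) * (F (rshift 2 0) * F (rshift 2 1)).
Proof.
by rewrite big_split_ord !prod_ord2.
Qed.

Lemma mpolyX_bimon d e (i : 'I_d.+1) (j : 'I_e.+1) :
  'X_[bimon i j] = xvar R 0 ^+ (d - i) * xvar R 1 ^+ i * (yvar R 0 ^+ (e - j) * yvar R 1 ^+ j).
Proof.
by rewrite mpolyXE_id prod_ord22; have [-> -> -> ->] := bimonE i j.
Qed.

Lemma mcoeff_biform d e (A : 'M[R]_(d.+1, e.+1)) i j : (biform A)@_(bimon i j) = A i j.
Proof.
rewrite /biform raddf_sum (bigD1 i)//= raddf_sum (bigD1 j)//=.
rewrite mcoeffZ mcoeffX eqxx mulr1 big1 ?addr0 => [|j' /negPf hj]; last first.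
  by rewrite mcoeffZ mcoeffX bimon_inj hj andbF mulr0.
rewrite big1 ?addr0 // => i' /negPf hi; rewrite raddf_sum big1//= => j' _.
by rewrite mcoeffZ mcoeffX bimon_inj hi mulr0.
Qed.

Lemma lin_subst_lshift g i : (lin_subst g)`_(lshift 2 i) = g i 0 *: xvar R 0 + g i 1 *: xvar R 1.
Proof.
by rewrite -tnth_nth tnth_mktuple -[lshift 2 i]/(unsplit (inl i)) unsplitK sum_ord2.
Qed.

Lemma lin_subst_rshift g i : (lin_subst g)`_(rshift 2 i) = g i 0 *: yvar R 0 + g i 1 *: yvar R 1.
Proof.
by rewrite -tnth_nth tnth_mktuple -[rshift 2 i]/(unsplit (inr i)) unsplitK sum_ord2.
Qed.

Lemma biform_lin_subst d e g (A : 'M[R]_(d.+1, e.+1)) :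
  biform A \mPo lin_subst g = biform ((sym_mx d g)^T *m A *m sym_mx e g).
Proof.
have homE n i (x y : {mpoly R[2 + 2]}) : (i <= n)%N ->
    (g 0 0 *: x + g 0 1 *: y) ^+ (n - i) * (g 1 0 *: x + g 1 1 *: y) ^+ i =
    \sum_(l < n.+1) (sym_poly n g i)`_l *: (x ^+ (n - l) * y ^+ l).
  move=> le_in; have := homogenize_sym_poly (map_mx (@mpolyC _ R) g) x y le_in.
  rewrite !mxE !mul_mpolyC => <-; apply: eq_bigr => l _.
  by rewrite -map_sym_poly coef_map /= -mul_mpolyC mulrA.
transitivity (\sum_(i < d.+1) \sum_(j < e.+1) \sum_(l < d.+1) \sum_(m < e.+1)
    ((sym_mx d g)^T l i * A i j * sym_mx e g j m) *: 'X_[R, bimon l m]).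
  rewrite /biform raddf_sum; apply: eq_bigr => i _ /=; rewrite raddf_sum.
  apply: eq_bigr => j _ /=; rewrite comp_mpolyZ mpolyX_bimon !rmorphM !rmorphXn /=.
  rewrite !comp_mpolyXU !lin_subst_lshift !lin_subst_rshift !homE ?leq_ord//.
  rewrite mulr_suml scaler_sumr; apply: eq_bigr => l _.
  rewrite mulr_sumr scaler_sumr; apply: eq_bigr => m _.
  rewrite mpolyX_bimon !mxE -scalerAl -scalerAr !scalerA; congr (_ *: _).
  by ring.
under eq_bigr => i _ do rewrite exchange_big.
rewrite exchange_big /biform; apply: eq_bigr => l _ /=.
under eq_bigr => i _ do rewrite exchange_big.
rewrite exchange_big; apply: eq_bigr => m _ /=.
rewrite !mxE scaler_suml exchange_big; apply: eq_bigr => j _ /=.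
by rewrite !mxE mulr_suml scaler_suml; apply: eq_bigr => i _; rewrite !mxE.
Qed.

Lemma conj_actE d e g (A : 'M[R]_(d.+1, e.+1)) :
  conj_act g A = (sym_mx d g)^T *m A *m sym_mx e g.
Proof.
by apply/matrixP => i j; rewrite mxE biform_lin_subst mcoeff_biform.
Qed.

Lemma conj_actM d e g h (A : 'M[R]_(d.+1, e.+1)) :
  conj_act (g *m h) A = conj_act h (conj_act g A).
Proof. by rewrite !conj_actE !sym_mxM trmx_mul !mulmxA. Qed.

Definition diag2 (a b : R) : 'M[R]_2 := \matrix_(i, j) ((if i == 0 then a else b) *+ (i == j)).

Lemma sym_mx_diag2 d (a b : R) (i j : 'I_d.+1) :
  sym_mx d (diag2 a b) i j = (a ^+ (d - i) * b ^+ i) *+ (i == j).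
Proof.
rewrite !mxE /sym_poly !mxE /= !mulr1n !mulr0n /linpoly scale0r addr0 add0r.
rewrite -polyC_exp coefCM exprZn coefZ coefXn eq_sym -val_eqE mulrA.
by case: eqP => _; rewrite ?mulr1 ?mulr0.
Qed.

Lemma conj_act_diag2 d e (a b : R) (A : 'M[R]_(d.+1, e.+1)) i j :
  conj_act (diag2 a b) A i j = a ^+ (d - i) * b ^+ i * (a ^+ (e - j) * b ^+ j) * A i j.
Proof.
rewrite conj_actE mxE (bigD1 j)//= sym_mx_diag2 eqxx mulr1n.
rewrite big1 ?addr0 => [|l /negPf hl]; last by rewrite sym_mx_diag2 hl mulr0.
rewrite mxE (bigD1 i)//= mxE sym_mx_diag2 eqxx mulr1n.
rewrite big1 ?addr0 => [|l /negPf hl]; last by rewrite mxE sym_mx_diag2 hl mul0r.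
by ring.
Qed.

End ConjAct.

Lemma map_conj_act (R S : comNzRingType) (f : {rmorphism R -> S}) d e g
    (A : 'M[R]_(d.+1, e.+1)) :
  map_mx f (conj_act g A) = conj_act (map_mx f g) (map_mx f A).
Proof. by rewrite !conj_actE !map_mxM -map_trmx !map_sym_mx. Qed.

Lemma det_mx2 (R : comNzRingType) (g : 'M[R]_2) : \det g = g 0 0 * g 1 1 - g 0 1 * g 1 0.
Proof.
rewrite (expand_det_row _ 0) sum_ord2 /cofactor !det_mx11 !mxE /= !expr0 !expr1.
rewrite mul1r mulN1r mulrN; congr (_ * g _ _ - _ * g _ _); exact/val_inj.
Qed.

(** * The apolar invariant *)

Section Apolar.

(** Gram matrix of the SL_2-invariant pairing of binary forms of degree d; the classical entries
    (-1)^i / C(d, i) are multiplied by d! to avoid division. *)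
Definition apolar_mx (R : comNzRingType) d : 'M[R]_d.+1 :=
  \matrix_(i, j) (((-1) ^+ i * (i`! * (d - i)`!)%:R) *+ (i + j == d)%N).

(** The coefficients of (x_0 + z x_1)^d. *)
Definition binomial_row (R : comNzRingType) d (z : R) : 'rV[R]_d.+1 :=
  \row_i ('C(d, i)%:R * z ^+ i).

Lemma map_apolar_mx (R S : comNzRingType) (f : {rmorphism R -> S}) d :
  map_mx f (apolar_mx R d) = apolar_mx S d.
Proof.
by apply/matrixP => i j; rewrite !mxE rmorphMn rmorphM rmorphXn rmorphN1 rmorph_nat.
Qed.

(** Both rows are d-th powers of linear forms. Since i! (d-i)! C(d, i)^2 = d! C(d, i), the pairing
    is the binomial expansion of a power of their determinant. *)
Lemma apolar_binomial_row (R : comNzRingType) d (a b a' b' : R) (u v : 'rV[R]_d.+1) :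
    (forall i : 'I_d.+1, u 0 i = 'C(d, i)%:R * (a ^+ (d - i) * b ^+ i)) ->
    (forall i : 'I_d.+1, v 0 i = 'C(d, i)%:R * (a' ^+ (d - i) * b' ^+ i)) ->
  (u *m apolar_mx R d *m v^T) 0 0 = d`!%:R * (a * b' - b * a') ^+ d.
Proof.
move=> hu hv; rewrite exprBn mulr_sumr mxE (reindex_inj rev_ord_inj) /=.
apply: eq_bigr => i _; have le_id := leq_ord i.
have hr : rev_ord i = (d - i)%N :> nat by rewrite /= subSS.
rewrite !mxE (bigD1 i)//= !mxE. rewrite hr subnKC// eqxx mulr1n.
rewrite big1 ?addr0 => [|l /negPf hl]; last first.
  rewrite !mxE hr (_ : (_ + _ == _)%N = false) ?mulr0n ?mulr0//.
  by apply/eqP => h; move/eqP: hl; apply; apply/val_inj => /=; lia.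
rewrite hu hv hr subKn// bin_sub// -(bin_fact le_id) !natrM !exprMn -[_ *+ 'C(d, i)]mulr_natr.
by ring.
Qed.

Lemma coef_linpoly_exp (R : comNzRingType) (a b : R) d (i : 'I_d.+1) :
  (linpoly a b ^+ d)`_i = 'C(d, i)%:R * (a ^+ (d - i) * b ^+ i).
Proof.
rewrite /linpoly exprDn coef_sum (bigD1 i)//= big1 ?addr0 => [|j /negPf hj].
  rewrite coefMn exprZn -polyC_exp coefCM coefZ coefXn eqxx mulr1.
  by rewrite mulr_natl.
rewrite coefMn exprZn -polyC_exp coefCM coefZ coefXn eq_sym -val_eqE in hj *.
by rewrite hj !mulr0 mul0rn.
Qed.

Lemma binomial_row_sym_mx (R : comNzRingType) d (g : 'M[R]_2) z (i : 'I_d.+1) :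
  (binomial_row d z *m sym_mx d g) 0 i =
  'C(d, i)%:R * ((g 0 0 + z * g 1 0) ^+ (d - i) * (g 0 1 + z * g 1 1) ^+ i).
Proof.
rewrite -coef_linpoly_exp.
have -> : linpoly (g 0 0 + z * g 1 0) (g 0 1 + z * g 1 1) =
    linpoly (g 0 0) (g 0 1) + z%:P * linpoly (g 1 0) (g 1 1).
  by rewrite /linpoly -!mul_polyC !polyCD !polyCM; ring.
rewrite exprDn coef_sum mxE; apply: eq_bigr => l _.
by rewrite !mxE coefMn exprMn mulrCA -polyC_exp coefCM -[RHS]mulr_natl mulrA.
Qed.

(** Powers of linear forms with independent parameters detect a bilinear form: each coefficient is
    an entry of the matrix times two binomials, which can be cancelled. *)
Lemma binomial_row_eq (R : comNzRingType) d (A B : 'M[R]_d.+1) :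
  (forall n, (0 < n)%N -> GRing.lreg (n%:R : R)) ->
  (binomial_row d ('X%:P : {poly {poly R}}) *m map_mx (polyC \o polyC) A *m (binomial_row d 'X)^T =
  binomial_row d 'X%:P *m map_mx (polyC \o polyC) B *m (binomial_row d 'X)^T) -> A = B.
Proof.
move=> natreg.
have coefE M (i j : 'I_d.+1) :
    ((binomial_row d ('X%:P : {poly {poly R}}) *m map_mx (polyC \o polyC) M *m
    (binomial_row d 'X)^T) 0 0)`_j`_i = 'C(d, i)%:R * ('C(d, j)%:R * M i j).
  have -> : (binomial_row d ('X%:P : {poly {poly R}}) *m map_mx (polyC \o polyC) M *m
      (binomial_row d 'X)^T) 0 0 = \sum_(l < d.+1)
      (\sum_(m < d.+1) ('C(d, m)%:R * ('C(d, l)%:R * M m l)) *: 'X^m) *: 'X^l.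
    rewrite mxE; apply: eq_bigr => l _; rewrite !mxE -mul_polyC mulrA; congr (_ * _).
    rewrite rmorph_sum mulr_suml; apply: eq_bigr => m _; rewrite !mxE /=.
    rewrite -mul_polyC !(rmorphM, rmorph_nat, rmorphXn) /=; ring.
  rewrite coef_sum (bigD1 j)//= coefZ coefXn eqxx mulr1 [X in _ + X]big1 ?addr0; last first.
    by move=> l /negPf hl; rewrite coefZ coefXn eq_sym val_eqE hl mulr0.
  rewrite coef_sum (bigD1 i)//= coefZ coefXn eqxx mulr1 [X in _ + X]big1 ?addr0//.
  by move=> l /negPf hl; rewrite coefZ coefXn eq_sym val_eqE hl mulr0.
move=> /(congr1 (fun M : 'M_1 => M 0 0)) AB; apply/matrixP => i j.
have /natreg : (0 < 'C(d, j))%N by rewrite bin_gt0 leq_ord.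
have /natreg : (0 < 'C(d, i))%N by rewrite bin_gt0 leq_ord.
by move=> hi hj; apply: hj; apply: hi; rewrite /= -!coefE AB.
Qed.

(** On powers of linear forms the pairing is a power of a determinant, which [g] multiplies by det g
    = 1; such powers suffice by [binomial_row_eq]. *)
Lemma sym_mx_apolar (R : comNzRingType) d (g : 'M[R]_2) :
  (forall n, (0 < n)%N -> GRing.lreg (n%:R : R)) ->
  \det g = 1 -> sym_mx d g *m apolar_mx R d *m (sym_mx d g)^T = apolar_mx R d.
Proof.
move=> natreg dg; apply: binomial_row_eq => //.
set f := (polyC \o polyC : {rmorphism R -> {poly {poly R}}}).
have dfg : \det (map_mx f g) = 1 by rewrite det_map_mx dg rmorph1.
rewrite !map_mxM -map_trmx map_apolar_mx map_sym_mx.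
transitivity (binomial_row d 'X%:P *m sym_mx d (map_mx f g) *m apolar_mx _ d *m
    (binomial_row d 'X *m sym_mx d (map_mx f g))^T).
  by rewrite trmx_mul !mulmxA.
apply/matrixP => i j; rewrite !ord1 {i j}.
rewrite (apolar_binomial_row (binomial_row_sym_mx _ _) (binomial_row_sym_mx _ _)).
rewrite (@apolar_binomial_row _ _ 1 'X%:P 1 'X); first last.
- by move=> i; rewrite !mxE expr1n mul1r.
- by move=> i; rewrite !mxE expr1n mul1r.
congr (_ * _ ^+ _); move: dfg; rewrite det_mx2 => dfg.
transitivity (('X - 'X%:P) * (map_mx f g 0 0 * map_mx f g 1 1 - map_mx f g 0 1 * map_mx f g 1 0)).
  by ring.
by rewrite dfg; ring.
Qed.

(** The tensor product of the two apolar pairings, evaluated at (A, A). *)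
Definition apolar_form (R : comNzRingType) d e (A : 'M[R]_(d.+1, e.+1)) : R :=
  \tr (apolar_mx R d *m A *m (apolar_mx R e)^T *m A^T).

Lemma apolar_form_conj_act (R : comNzRingType) d e (g : 'M[R]_2) (A : 'M[R]_(d.+1, e.+1)) :
  (forall n, (0 < n)%N -> GRing.lreg (n%:R : R)) ->
  \det g = 1 -> apolar_form (conj_act g A) = apolar_form A.
Proof.
move=> natreg dg; have hd := sym_mx_apolar d natreg dg.
have := congr1 trmx (sym_mx_apolar e natreg dg); rewrite !trmx_mul trmxK mulmxA => he.
rewrite /apolar_form conj_actE !trmx_mul trmxK -[in RHS]hd -[in RHS]he !mulmxA.
by rewrite mxtrace_mulC !mulmxA.
Qed.

Lemma map_apolar_form (R S : comNzRingType) (f : {rmorphism R -> S}) d e (A : 'M[R]_(d.+1, e.+1)) :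
  f (apolar_form A) = apolar_form (map_mx f A).
Proof.
by rewrite /apolar_form -trace_map_mx !map_mxM -!map_trmx !map_apolar_mx.
Qed.

End Apolar.

(** * The torus-fixed form when d + e is even *)

Section Even.

Lemma apolar_formE (R : comNzRingType) d e (A : 'M[R]_(d.+1, e.+1)) :
  apolar_form A = \sum_(i < d.+1) \sum_(j < e.+1)
    (-1) ^+ (i + j) * (i`! * (d - i)`! * (j`! * (e - j)`!))%:R *
      A (rev_ord i) (rev_ord j) * A i j.
Proof.
have apolarE n (i j : 'I_n.+1) : apolar_mx R n i j =
    ((-1) ^+ i * (i`! * (n - i)`!)%:R) *+ (j == rev_ord i).
  rewrite !mxE; congr (_ *+ nat_of_bool _); apply/eqP/eqP => [h|->].
    by apply/val_inj; rewrite /= subSS; lia.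
  by rewrite /= subSS subnKC// -ltnS.
rewrite /apolar_form; apply: eq_bigr => i _; rewrite mxE; apply: eq_bigr => j _.
rewrite [A^T _ _]mxE; congr (_ * _).
rewrite mxE (bigD1 (rev_ord j))//= big1 ?addr0 => [|l /negPf hl]; last first.
  by rewrite [_^T _ _]mxE apolarE hl mulr0.
rewrite mxE (bigD1 (rev_ord i))//= big1 ?addr0 => [|l /negPf hl]; last first.
  by rewrite apolarE hl mul0r.
rewrite [_^T _ _]mxE !apolarE !eqxx !mulr1n exprD !natrM; ring.
Qed.

Variables (k : fieldType) (hk : [pchar k] =i pred0).

Lemma natr_neq0 n : (0 < n)%N -> n%:R != 0 :> k.
Proof. by move=> n_gt0; have /pcharf0P -> := hk; rewrite -lt0n. Qed.

Lemma natr_lreg (R : comNzRingType) (phi : {rmorphism k -> R}) n :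
  (0 < n)%N -> GRing.lreg (n%:R : R).
Proof.
move=> n_gt0 x y /= /(congr1 ( *%R (phi n%:R^-1))).
by rewrite -(rmorph_nat phi) !mulrA -rmorphM mulVf ?natr_neq0// rmorph1 !mul1r.
Qed.

Definition apolar_section d e : coord_ring k d e :=
  apolar_form (vec_mx (\row_i 'X_i)).

Lemma apolar_sectionE d e (R : comNzRingType) (phi : {rmorphism k -> R})
    (A : 'M[R]_(d.+1, e.+1)) : section_value phi (apolar_section d e) A = apolar_form A.
Proof.
rewrite /section_value -[LHS]/((meval (mxvec A 0) \o map_mpoly phi) _).
rewrite /apolar_section map_apolar_form; congr apolar_form.
rewrite -[RHS](mxvecK A) map_vec_mx; congr vec_mx; apply/rowP => i.
by rewrite !mxE /= map_mpolyX mevalXU.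
Qed.

Lemma apolar_section_invariant d e : invariant_section 2 (apolar_section d e).
Proof.
split; last first.
  move=> R phi g A dg; rewrite !apolar_sectionE apolar_form_conj_act//.
  exact: natr_lreg.
rewrite /apolar_section apolar_formE; apply: rpred_sum => i _; apply: rpred_sum => j _.
rewrite -mulrA -(rmorph_nat (@mpolyC _ k)) -(rmorphN1 (@mpolyC _ k)).
rewrite -rmorphXn -rmorphM /= mul_mpolyC.
apply: dhomogZ; rewrite !mxE (dhomogM (d:=1%N) (e:=1%N))// dhomogX; apply/eqP; exact: mdeg1.
Qed.

Variables (K : closedFieldType) (phi : {rmorphism k -> K}) (d e m : nat).

Definition zero_weight_mx : 'M[K]_(d.+1, e.+1) := \matrix_(i, j) ((i + j == m)%N)%:R.

Hypothesis dem : (d + e = m.*2)%N.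

Lemma zero_weight_index : exists (i : 'I_d.+1) (j : 'I_e.+1), (i + j = m)%N.
Proof.
have hi : (minn d m < d.+1)%N by lia.
have hj : (m - minn d m < e.+1)%N by lia.
by exists (Ordinal hi), (Ordinal hj) => /=; lia.
Qed.

(** All monomials of weight zero have i + j = m, so the terms of the apolar form carry the same sign
    (-1)^m and cannot cancel: up to sign they add up to a positive integer. *)
Lemma zero_weight_semistable : semistable phi zero_weight_mx.
Proof.
exists 2%N, (apolar_section d e); split => //; first exact: apolar_section_invariant.
rewrite apolar_sectionE apolar_formE.
have hle (i : 'I_d.+1) (j : 'I_e.+1) : (i <= d /\ j <= e)%N by rewrite !leq_ord.
have -> : \sum_(i < d.+1) \sum_(j < e.+1) (-1) ^+ (i + j) *
    (i`! * (d - i)`! * (j`! * (e - j)`!))%:R *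
      zero_weight_mx (rev_ord i) (rev_ord j) * zero_weight_mx i j =
    (-1) ^+ m * (\sum_(i < d.+1) \sum_(j < e.+1)
    (i + j == m)%N * (i`! * (d - i)`! * (j`! * (e - j)`!)))%N%:R.
  rewrite natr_sum mulr_sumr; apply: eq_bigr => i _.
  rewrite natr_sum mulr_sumr; apply: eq_bigr => j _.
  rewrite !mxE /= !subSS; have [ij|_] := eqVneq (i + j)%N m; last by rewrite mul0n !mulr0.
  have [hi hj] := hle i j.
  by rewrite (_ : (_ + _ == m)%N = true) ?mulr1 ?mul1n ?ij//; apply/eqP; lia.
rewrite mulf_eq0 signr_eq0 /= -(rmorph_nat phi) fmorph_eq0 natr_neq0//.
have [i0 [j0 ij0]] := zero_weight_index.
rewrite (bigD1 i0)//= (bigD1 j0)//= ij0 eqxx mul1n.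
by rewrite !addn_gt0 !muln_gt0 !fact_gt0.
Qed.

Lemma zero_weight_neq0 : zero_weight_mx != 0.
Proof.
have [i [j ij]] := zero_weight_index.
by apply/eqP => /matrixP/(_ i j)/eqP; rewrite !mxE ij eqxx oner_eq0.
Qed.

Lemma zero_weight_stabilizer (t : K) : t != 0 -> in_stabilizer zero_weight_mx (diag2 t t^-1).
Proof.
move=> t0; split.
  by rewrite /SL2 det_mx2 !mxE /= !mulr1n !mulr0n mul0r subr0 divff.
exists 1; rewrite ?oner_neq0// scale1r; apply/matrixP => i j.
rewrite conj_act_diag2 !mxE; have [ij|] := eqVneq (i + j)%N m; last by rewrite mulr0.
rewrite mulr1 mulrACA -!exprD !exprVn ij.
rewrite (_ : (d - i + (e - j))%N = m) ?mulfV ?expf_neq0//.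
by have := ltn_ord i; have := ltn_ord j; lia.
Qed.

Lemma zero_weight_not_stable : ~ stable phi zero_weight_mx.
Proof.
move=> [[gs hgs] _].
(* One more torus element than [gs] has members; they are distinct because positive integers are
   distinct in characteristic zero. *)
pose ts := [seq (diag2 n.+1%:R n.+1%:R^-1 : 'M[K]_2) | n <- iota 0 (size gs).+1].
have natK n : n.+1%:R != 0 :> K by rewrite -(rmorph_nat phi) fmorph_eq0 natr_neq0.
have uniq_ts : uniq ts.
  rewrite map_inj_uniq ?iota_uniq// => a b /matrixP/(_ 0 0); rewrite !mxE /= !mulr1n => ab.
  wlog le_ab : a b ab / (a <= b)%N; first by case/orP: (leq_total a b) => h /(_ _ _ _ h) ->.
  have : ((b - a)%N%:R : K) == 0 by rewrite -subSS natrB// ab subrr.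
  case: (b - a)%N (subnKC le_ab) => [<- _|c _ /eqP h]; first by rewrite addn0.
  by have := natK c; rewrite h eqxx.
suff /(uniq_leq_size uniq_ts) : {subset ts <= gs} by rewrite size_map size_iota ltnn.
by move=> g /mapP [n _ ->]; apply/hgs/zero_weight_stabilizer.
Qed.

End Even.

(** * Specialization along integral extensions *)

(** The integers 1, ..., [size p] are distinct in characteristic zero and outnumber the roots of
    [p]. *)
Lemma nat_nonroot (F : fieldType) (hF : [pchar F] =i pred0) (p : {poly F}) :
  p != 0 -> exists n, ~~ root p n.+1%:R.
Proof.
move=> p0; apply: boolp.contrapT => /boolp.forallNP h.
pose ts := [seq n.+1%:R : F | n <- iota 0 (size p)].
have uts : uniq ts.
  rewrite map_inj_uniq ?iota_uniq// => a b ab.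
  wlog le_ab : a b ab / (a <= b)%N; first by case/orP: (leq_total a b) => hab /(_ _ _ _ hab) ->.
  have /eqP : ((b - a)%N%:R : F) = 0 by rewrite -subSS natrB// ab subrr.
  by have /pcharf0P -> := hF; rewrite subn_eq0 => hab; apply/eqP; rewrite eqn_leq le_ab.
suff : (size ts < size p)%N by rewrite size_map size_iota ltnn.
apply: max_poly_roots => //; apply/allP => x /mapP [n _ ->].
by have /negP := h n; rewrite negbK.
Qed.

Lemma poly_eq0_nat (F : fieldType) (hF : [pchar F] =i pred0) (p : {poly F}) :
  (forall n, root p n.+1%:R) -> p = 0.
Proof.
by move=> h; apply/eqP; apply: contraT => /(nat_nonroot hF)[n]; rewrite h.
Qed.

Lemma det_horner_mx_eigen (F : fieldType) n (A : 'M[F]_n.+1) (p : {poly F}) x :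
  root (char_poly A) x -> root p x -> \det (horner_mx A p) = 0.
Proof.
rewrite -eigenvalue_root_char => /eigenvalueP [v vA v0] /factor_theorem [q ->].
apply/eqP/det0P; exists v => //.
have vq : v *m horner_mx A ('X - x%:P) = 0.
  by rewrite rmorphB /= horner_mx_X horner_mx_C mulmxBr vA mul_mx_scalar subrr.
by rewrite mulrC rmorphM /= mulmxA vq mul0mx.
Qed.

(** Here p is coprime to the characteristic polynomial, and by Cayley-Hamilton the Bezout identity
    inverts p(A). *)
Lemma det_horner_mx_neq0 (F : closedFieldType) n (A : 'M[F]_n.+1) (p : {poly F}) :
  (forall x, root (char_poly A) x -> ~~ root p x) -> \det (horner_mx A p) != 0.
Proof.
move=> h; have /Bezout_eq1_coprimepP [[u v] /= uv] : coprimep p (char_poly A).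
  rewrite /coprimep; apply: contraT => /closed_rootP [x].
  by rewrite root_gcd => /andP [px /h]; rewrite px.
have := congr1 (fun q => \det (horner_mx A q)) uv.
rewrite rmorphD !rmorphM /= Cayley_Hamilton mulr0 addr0 rmorph1 det_mulmx det1.
by move=> /eqP; apply: contraTneq => ->; rewrite mulr0 eq_sym oner_eq0.
Qed.

Lemma monic_char_poly (R : comNzRingType) (q : {poly R}) : q \is monic -> (1 < size q)%N ->
  exists n (A : 'M[R]_n.+1), char_poly A = q.
Proof.
move=> /companionmxK; move: (companionmx q).
by case: (size q) => [|[|n]]//= A hA _; exists n, A.
Qed.

(* Homomorphisms R -> L play the role of L-points; phi lies in the Zariski closure of the ev t. *)
Definition specializes (R L : nzRingType) (T : Type) (ev : T -> {rmorphism R -> L})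
  (phi : {rmorphism R -> L}) := forall r, (forall t, ev t r = 0) -> phi r = 0.

Section Specialization.
Variables (R : comNzRingType) (L : closedFieldType) (hL : [pchar L] =i pred0) (T : Type).
Implicit Types (ev : T -> {rmorphism R -> L}) (phi : {rmorphism R -> L}).

(** The point of the affine line over [phi] with coordinate x. *)
Definition ext_ev phi (x : L) : {rmorphism {poly R} -> L} := horner_eval x \o map_poly phi.
Arguments ext_ev : simpl never.

Lemma ext_evC phi x r : ext_ev phi x r%:P = phi r.
Proof. by rewrite /ext_ev /= map_polyC horner_evalE hornerC. Qed.

Lemma ext_evX phi x : ext_ev phi x 'X = x.
Proof. by rewrite /ext_ev /= map_polyX horner_evalE hornerX. Qed.

Lemma affine_poly_eq0 (a b : L) : a%:P + b *: 'X = 0 -> a = 0 /\ b = 0.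
Proof.
move=> /polyP abE; have := abE 0%N; have := abE 1%N.
by rewrite !coefD !coefC !coefZ !coefX /= mulr0 mulr1 add0r addr0.
Qed.

(** The polynomials vanishing at all points (ev t, x t) form an ideal; if each y of a finite set is
    avoided by some member, a combination p + c q with generic c avoids them all. *)
Lemma specializes_avoid ev phi (x : T -> L) (xs : seq L) :
  (forall y, y \in xs -> exists2 p, forall t, ext_ev (ev t) (x t) p = 0 & ext_ev phi y p != 0) ->
  exists2 p, forall t, ext_ev (ev t) (x t) p = 0 & forall y, y \in xs -> ext_ev phi y p != 0.
Proof.
elim: xs => [|a xs IHxs] h; first by exists 0 => // t; rewrite rmorph0.
have [p hp pxs] : exists2 p, forall t, ext_ev (ev t) (x t) p = 0 &
    forall y, y \in xs -> ext_ev phi y p != 0.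
  by apply: IHxs => y yxs; apply: h; rewrite inE yxs orbT.
have [q hq qa] := h a (mem_head _ _).
(* The roots of P are the values of c for which p + c q vanishes at one of the points. *)
pose P := \prod_(y <- a :: xs) ((ext_ev phi y p)%:P + ext_ev phi y q *: 'X).
have [n Pn] : exists n, ~~ root P n.+1%:R.
  apply: nat_nonroot => //; rewrite prodf_seq_neq0; apply/allP => y y_in; apply/implyP => _.
  apply/eqP => /affine_poly_eq0 [p0 q0].
  move: y_in; rewrite inE => /orP [/eqP ya|/pxs]; last by move/eqP; apply.
  by rewrite -ya q0 eqxx in qa.
exists (p + n.+1%:R * q) => [t|y y_in]; first by rewrite rmorphD rmorphM hp hq mulr0 addr0.
move: Pn; rewrite /root horner_prod prodf_seq_neq0 => /allP/(_ y y_in)/implyP/(_ isT).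
by rewrite hornerD hornerC hornerZ hornerX rmorphD rmorphM rmorph_nat mulrC.
Qed.

(* If every root y of char_poly (phi A) were excluded by some p vanishing at all (ev t, x t), a
   single such p would avoid all of them; then det (p(A)) vanishes at every ev t but not at phi. *)
Lemma specializes_ext ev phi n (A : 'M[R]_n.+1) (x : T -> L) :
    specializes ev phi -> (forall t, root (char_poly (map_mx (ev t) A)) (x t)) ->
  exists y, specializes (fun t => ext_ev (ev t) (x t)) (ext_ev phi y).
Proof.
move=> sp hA; pose chi := char_poly (map_mx phi A).
have [xs chiE] := closed_field_poly_normal chi.
have chi_xs y : root chi y -> y \in xs.
  by rewrite chiE (monicP (char_poly_monic _)) scale1r root_prod_XsubC.
apply: boolp.contrapT => /boolp.forallNP H.
have [p hp pxs] : exists2 p, forall t, ext_ev (ev t) (x t) p = 0 &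
    forall y, y \in xs -> ext_ev phi y p != 0.
  apply: specializes_avoid => y _; have /boolp.existsNP [p] := H y.
  by move=> /boolp.not_implyP [hp /eqP py]; exists p.
have : phi (\det (horner_mx A p)) = 0.
  apply: sp => t; rewrite -det_map_mx map_horner_mx.
  by apply: det_horner_mx_eigen (hA t) _; apply/eqP/hp.
by apply/eqP; rewrite -det_map_mx map_horner_mx det_horner_mx_neq0// => y /chi_xs/pxs.
Qed.

Lemma specializes_monic ev phi (q : {poly R}) (x : T -> L) :
    specializes ev phi -> q \is monic -> (1 < size q)%N ->
    (forall t, ext_ev (ev t) (x t) q = 0) ->
  exists y, specializes (fun t => ext_ev (ev t) (x t)) (ext_ev phi y).
Proof.
move=> sp qm q1 hq; have [n [A Aq]] := monic_char_poly qm q1.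
apply: (specializes_ext (A := A)) => // t.
by rewrite -map_char_poly Aq; apply/eqP/hq.
Qed.
End Specialization.

(** * Functions of bounded degree and integrality *)

Section PolynomialFunctions.
Variables (R : comNzRingType) (L : fieldType) (T : Type) (ev : T -> {rmorphism R -> L}).
Variables (m : nat) (x : T -> 'I_m -> L).

(** Only the degree in [x] counts; coefficients from [R] have degree zero. [msize] is the total
    degree plus one. *)
Definition degree_le (n : nat) (F : T -> L) :=
  exists2 p : {mpoly R[m]}, (msize p <= n.+1)%N & forall t, F t = mmap (ev t) (x t) p.

Lemma eq_degree_le n F G : F =1 G -> degree_le n F -> degree_le n G.
Proof. by move=> FG [p sp hp]; exists p => // t; rewrite -FG. Qed.

Lemma degree_leW n1 n2 F : (n1 <= n2)%N -> degree_le n1 F -> degree_le n2 F.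
Proof. by move=> le12 [p sp hp]; exists p => //; apply: leq_trans sp _. Qed.

Lemma degree_leC n r : degree_le n (fun t => ev t r).
Proof.
by exists r%:MP => [|t]; [rewrite msizeC (leq_trans (leq_b1 _))|rewrite mmapC].
Qed.

Lemma degree_le_var i : degree_le 1 (fun t => x t i).
Proof. by exists 'X_i => [|t]; rewrite ?msizeX ?mdeg1 ?mmapX ?mmap1U. Qed.

Lemma degree_leD n F G : degree_le n F -> degree_le n G -> degree_le n (fun t => F t + G t).
Proof.
move=> [p sp hp] [q sq hq]; exists (p + q) => [|t]; last by rewrite rmorphD /= hp hq.
by rewrite (leq_trans (msizeD_le _ _))// geq_max sp.
Qed.

Lemma degree_leM n1 n2 F G :
  degree_le n1 F -> degree_le n2 G -> degree_le (n1 + n2) (fun t => F t * G t).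
Proof.
move=> [p sp hp] [q sq hq]; exists (p * q) => [|t]; last by rewrite rmorphM /= hp hq.
have [->|p0] := eqVneq p 0; first by rewrite mul0r msize0.
have [->|q0] := eqVneq q 0; first by rewrite mulr0 msize0.
have [->|pq0] := eqVneq (p * q) 0; first by rewrite msize0.
move: sp sq; rewrite -!mlead_deg// !ltnS => sp sq.
by rewrite (leq_trans (lemc_mdeg (mleadM_le p q)))// mdegD leq_add.
Qed.

Lemma degree_leZ n r F : degree_le n F -> degree_le n (fun t => ev t r * F t).
Proof. by move=> hF; apply: (degree_leM (n1 := 0)) hF; apply: degree_leC. Qed.

Lemma degree_leX n k F : degree_le n F -> degree_le (n * k) (fun t => F t ^+ k).
Proof.
move=> hF; elim: k => [|k IHk].
  by apply: eq_degree_le (degree_leC _ 1) => t; rewrite rmorph1.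
by rewrite mulnS; apply: eq_degree_le (degree_leM hF IHk) => t; rewrite exprS.
Qed.

Lemma degree_le_sum (I : Type) (s : seq I) (P : pred I) n (F : I -> T -> L) :
  (forall i, P i -> degree_le n (F i)) -> degree_le n (fun t => \sum_(i <- s | P i) F i t).
Proof.
move=> hF; elim: s => [|i s IHs].
  by apply: eq_degree_le (degree_leC n 0) => t; rewrite rmorph0 big_nil.
case Pi : (P i); last by apply: eq_degree_le IHs => t; rewrite big_cons Pi.
by apply: eq_degree_le (degree_leD (hF _ Pi) IHs) => t; rewrite big_cons Pi.
Qed.

Lemma degree_le_monomial (a : 'X_{1..m}) :
  degree_le (mdeg a) (fun t => mmap (ev t) (x t) 'X_[a]).
Proof. by exists 'X_[a] => //; rewrite msizeX. Qed.

Variable N : nat.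
Hypothesis hN : forall i, degree_le N (fun t => x t i ^+ N.+1).

(* A monomial of degree > m * N has an exponent > N, so [hN] lowers its degree. *)
Lemma degree_le_reduce n F : degree_le n F -> degree_le (m * N) F.
Proof.
have [/degree_leW h|] := leqP n (m * N); first exact: h.
elim: n F => // n IHn F le_n hF.
suff hFn : degree_le n F.
  by have [/IHn|le_n'] := ltnP (m * N) n; [apply|apply: degree_leW hFn; lia].
have [p sp hp] := hF; apply: (@eq_degree_le _ (fun t => \sum_(a <- msupp p | a \in msupp p)
   ev t p@_a * mmap (ev t) (x t) 'X_[a])).
  by move=> t; rewrite -big_seq hp {3}[p]mpolyE rmorph_sum; apply: eq_bigr => a _ /=; rewrite mmapZ.
apply: degree_le_sum => a /msize_mdeg_lt a_lt; apply: degree_leZ.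
have [a_le|a_gt] := leqP (mdeg a) n; first exact: degree_leW (degree_le_monomial a).
have [i a_i] : exists i, (N < a i)%N.
  apply/existsP; apply: contraLR (leq_trans le_n (a_gt : n < mdeg a)%N) => /existsPn a_small.
  rewrite -leqNgt mdegE -[X in (_ <= X * _)%N]card_ord -sum_nat_const.
  by apply: leq_sum => i _; rewrite leqNgt a_small.
pose b := (a - U_(i) *+ N.+1)%MM.
have aE : a = (U_(i) *+ N.+1 + b)%MM.
  rewrite addmC submK//; apply/mnm_lepP => j; rewrite mulmnE mnm1E.
  by case: eqP => [<-|]; rewrite ?mul1n ?mul0n.
apply: (@eq_degree_le _ (fun t => x t i ^+ N.+1 * mmap (ev t) (x t) 'X_[b])).
  by move=> t; rewrite aE mpolyXD rmorphM -mpolyXn rmorphXn /= !mmapX mmap1U.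
apply: degree_leW (degree_leM (hN i) (degree_le_monomial b)).
by have := congr1 mdeg aE; rewrite mdegD mdegMn mdeg1; lia.
Qed.

(** By [degree_le_reduce], the monomials of degree at most D span a module stable under
    multiplication by each variable; the determinant trick then gives one monic equation for all
    t. *)
Lemma integral_of_degree_le i : exists q : {poly R},
  [/\ q \is monic, (1 < size q)%N & forall t, root (map_poly (ev t) q) (x t i)].
Proof.
pose D := (m * N)%N; pose I : finType := 'X_{1..m < D.+1}.
have redI (a : I) : exists p : {mpoly R[m]}, (msize p <= D.+1)%N /\
    forall t, x t i * mmap (ev t) (x t) 'X_[a] = mmap (ev t) (x t) p.
  have [p sp hp] := degree_le_reduce (degree_leM (degree_le_var i) (degree_le_monomial a)).
  by exists p.
have [P hP] := fin_all_exists redI.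
pose A : 'M[R]_#|I| := \matrix_(u, v) (P (enum_val v))@_(val (enum_val u)).
exists (char_poly A); rewrite char_poly_monic size_char_poly ltnS; split => // [|t].
  have h0 : (mdeg (0%MM : 'X_{1..m}) < D.+1)%N by rewrite mdeg0.
  by apply/card_gt0P; exists (BMultinom h0).
rewrite map_char_poly -eigenvalue_root_char; apply/eigenvalueP.
exists (\row_v mmap (ev t) (x t) 'X_[(enum_val v : I)]).
  apply/rowP => v; rewrite !mxE; have [sP ->] := hP (enum_val v).
  rewrite {1}(mpolywE sP) rmorph_sum /= [RHS](reindex_onto enum_val enum_rank); last first.
    by move=> a _; rewrite enum_rankK.
  rewrite [RHS](eq_bigl xpredT); last by move=> u /=; rewrite enum_valK eqxx.
  by apply: eq_bigr => u _; rewrite !mxE mmapZ mulrC.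
(* The eigenvector is nonzero: its entry at the monomial 1 is 1. *)
apply/eqP => /rowP.
have h0 : (mdeg (0%MM : 'X_{1..m}) < D.+1)%N by rewrite mdeg0.
move=> /(_ (enum_rank (BMultinom h0 : I)))/eqP.
by rewrite !mxE enum_rankK /= mpolyX0 rmorph1 oner_eq0.
Qed.

End PolynomialFunctions.

Section CoefficientDegree.
Variables (R : comNzRingType) (L : fieldType) (T : Type) (ev : T -> {rmorphism R -> L}).
Variables (m : nat) (x : T -> 'I_m -> L).

Definition coef_degree_le (F : T -> {poly L}) := forall i, degree_le ev x i (fun t => (F t)`_i).

Lemma coef_degree_leM F G :
  coef_degree_le F -> coef_degree_le G -> coef_degree_le (fun t => F t * G t).
Proof.
move=> hF hG i.
apply: (@eq_degree_le _ _ _ _ _ _ _ (fun t => \sum_(j < i.+1) (F t)`_j * (G t)`_(i - j))).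
  by move=> t; rewrite coefM.
apply: degree_le_sum => j _; rewrite -[in X in degree_le _ _ X](subnKC (leq_ord j)).
exact: degree_leM.
Qed.

Lemma coef_degree_leX F n : coef_degree_le F -> coef_degree_le (fun t => F t ^+ n).
Proof.
move=> hF; elim: n => [|n IHn] i; last first.
  by apply: eq_degree_le (coef_degree_leM hF IHn i) => t; rewrite exprS.
apply: (@eq_degree_le _ _ _ _ _ _ _ (fun t => ev t (i == 0)%N%:R)) (degree_leC _ _ _ _).
by move=> t; rewrite expr0 coef1 rmorph_nat.
Qed.

Lemma coef_degree_le_linpoly r (b : T -> L) : degree_le ev x 1 b ->
  coef_degree_le (fun t => linpoly (ev t r) (b t)).
Proof.
move=> hb i; have cE t : (linpoly (ev t r) (b t))`_i =
    if i is j.+1 then ev t (i == 1)%N%:R * b t else ev t r.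
  rewrite /linpoly coefD coefC coefZ coefX rmorph_nat.
  by case: i => [|j]; rewrite /= ?mulr0 ?addr0// add0r mulrC.
apply: (eq_degree_le (fun t => esym (cE t))).
by case: i {cE} => [|j]; [apply: degree_leC|apply: degree_leW (degree_leZ _ hb)].
Qed.

(** In the l-th coefficient of [sym_poly] exactly l factors come from the second column, while the
    first column has degree zero. *)
Lemma degree_le_conj_act d e (g : T -> 'M[L]_2) (Y : 'M[R]_(d.+1, e.+1))
    (i : 'I_d.+1) (j : 'I_e.+1) :
    (forall a, exists r, forall t, g t a 0 = ev t r) ->
    (forall a, degree_le ev x 1 (fun t => g t a 1)) ->
  degree_le ev x (i + j) (fun t => conj_act (g t) (map_mx (ev t) Y) i j).
Proof.
move=> hg0 hg1; have lin a : coef_degree_le (fun t => linpoly (g t a 0) (g t a 1)).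
  have [r hr] := hg0 a => i'.
  by apply: eq_degree_le (coef_degree_le_linpoly r (hg1 a) i') => t; rewrite hr.
have sym n i' l : degree_le ev x l (fun t => (sym_poly n (g t) i')`_l).
  by apply: coef_degree_leM; apply: coef_degree_leX.
apply: (@eq_degree_le _ _ _ _ _ _ _ (fun t => \sum_(b < e.+1) \sum_(a < d.+1)
    (sym_poly d (g t) a)`_i * (ev t (Y a b) * (sym_poly e (g t) b)`_j))).
  move=> t; rewrite conj_actE mxE; apply: eq_bigr => b _; rewrite mxE mulr_suml.
  by apply: eq_bigr => a _; rewrite !mxE mulrA.
apply: degree_le_sum => b _; apply: degree_le_sum => a _.
by apply: degree_leM => //; apply: degree_leZ.
Qed.
End CoefficientDegree.

(** * Instability and the relation satisfied by group elements *)

(* Otherwise [mxE] unfolds [conj_act] into its definition by multivariate substitution. *)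
Local Opaque conj_act.

Definition mat2 (R : comNzRingType) (a b c d : R) : 'M[R]_2 :=
  \matrix_(i, j) (if i == 0 then if j == 0 then a else b else if j == 0 then c else d).

Lemma ord2P (i : 'I_2) : {i = 0} + {i = 1}.
Proof. by case: i => [[|[|//]] hi]; [left|right]; apply/val_inj. Qed.

(** The gcd of the family is a combination of its members; having no root in a closed field, it is a
    constant. *)
Lemma bezout_family (L : closedFieldType) (I : finType) (P : I -> {poly L}) :
  (forall z, exists i, ~~ root (P i) z) -> exists a : I -> {poly L}, \sum_i a i * P i = 1.
Proof.
move=> hP; have [g hg [a ha]] : exists2 g, forall i, i \in enum I -> g %| P i &
    exists a : I -> {poly L}, g = \sum_(i <- enum I) a i * P i.
  elim: (enum I) (enum_uniq I) => [|j s IHs] /=.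
    by exists 0 => //; exists (fun=> 0); rewrite big_nil.
  move=> /andP [js /IHs [g hg [a ga]]].
  have [[u v] /= uv] := Bezoutp (P j) g.
  exists (u * P j + v * g).
    move=> i; rewrite (eqp_dvdl _ uv) inE => /orP [/eqP->|/hg]; first exact: dvdp_gcdl.
    by apply: dvdp_trans; apply: dvdp_gcdr.
  exists (fun i => if i == j then u else v * a i).
  rewrite big_cons eqxx ga mulr_sumr; congr (_ + _); rewrite !big_seq.
  by apply: eq_bigr => i si; rewrite ifN ?mulrA//; apply: contraNneq js => <-.
have g1 : size g == 1%N.
  apply: contraT => /closed_rootP [z gz]; have [i] := hP z.
  by have /dvdpP [q ->] := hg i (mem_enum _ _); rewrite rootM gz orbT.
have [c c0 gc] := size_poly1P _ g1.
exists (fun i => c^-1%:P * a i).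
under eq_bigr do rewrite -mulrA.
by rewrite -mulr_sumr -big_enum -ha gc -polyCM mulVf.
Qed.

Lemma rmorph_mmap (R S S' : comNzRingType) (f : {rmorphism R -> S}) (g : {rmorphism S -> S'})
    N (h : 'I_N -> S) (p : {mpoly R[N]}) : g (mmap f h p) = mmap (g \o f) (g \o h) p.
Proof.
rewrite /mmap rmorph_sum; apply: eq_bigr => a _; rewrite rmorphM; congr (_ * _).
by rewrite /mmap1 rmorph_prod; apply: eq_bigr => i _; rewrite rmorphXn.
Qed.

Lemma eq_mmap (R S : comNzRingType) (f f' : R -> S) N (h h' : 'I_N -> S) (p : {mpoly R[N]}) :
  f =1 f' -> h =1 h' -> mmap f h p = mmap f' h' p.
Proof.
move=> ff' hh'; rewrite /mmap; apply: eq_bigr => a _; rewrite ff'; congr (_ * _).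
by rewrite /mmap1; apply: eq_bigr => i _; rewrite hh'.
Qed.

Lemma section_valueE (k R : comNzRingType) (phi : {rmorphism k -> R}) d e
    (s : coord_ring k d e) (A : 'M[R]_(d.+1, e.+1)) :
  section_value phi s A = mmap phi (mxvec A 0) s.
Proof.
rewrite /section_value -[map_mpoly phi s]/(mmap _ _ s) (rmorph_mmap (@mpolyC _ R \o phi)).
by apply: eq_mmap => [c|i] /=; rewrite ?mevalC ?mevalXU.
Qed.

Lemma rmorph_section_value (k R S : comNzRingType) (phi : {rmorphism k -> R})
    (f : {rmorphism R -> S}) d e (s : coord_ring k d e) (A : 'M[R]_(d.+1, e.+1)) :
  f (section_value phi s A) = section_value (f \o phi) s (map_mx f A).
Proof.
rewrite !section_valueE (rmorph_mmap phi); apply: eq_mmap => // i.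
by rewrite -map_mxvec mxE.
Qed.

Lemma eq_section_value (k R : comNzRingType) (phi psi : {rmorphism k -> R}) d e
    (s : coord_ring k d e) (A : 'M[R]_(d.+1, e.+1)) :
  phi =1 psi -> section_value phi s A = section_value psi s A.
Proof. by move=> eq_phi; rewrite !section_valueE; apply: eq_mmap. Qed.

Section Instability.
Variables (k : fieldType) (L : closedFieldType) (phi : {rmorphism k -> L}).
Variables (hL : [pchar L] =i pred0) (d e n : nat) (s : coord_ring k d e).
Hypotheses (de_odd : odd (d + e)) (n_gt0 : (0 < n)%N) (s_inv : invariant_section n s).

Lemma section_value_conj_act g (A : 'M[L]_(d.+1, e.+1)) : \det g = 1 ->
  section_value phi s (conj_act g A) = section_value phi s A.
Proof. by move=> dg; case: s_inv => _; apply. Qed.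

Lemma meval_homog (R : comNzRingType) N m (p : {mpoly R[N]}) (c : R) (v w : 'I_N -> R) :
  p \is m.-homog -> (forall i, v i = c * w i) -> p.@[v] = c ^+ m * p.@[w].
Proof.
move=> /dhomogP hp vE; rewrite !mevalE mulr_sumr !big_seq; apply: eq_bigr => a /hp <-.
rewrite mulrCA; congr (_ * _); rewrite -[X in c ^+ X]/(mdeg a) mdegE expr_sum -big_split.
by apply: eq_bigr => i _; rewrite vE exprMn.
Qed.

Lemma map_homog : map_mpoly phi s \is n.-homog.
Proof.
case: s_inv => /dhomogP hs _; apply/dhomogP => a.
rewrite mcoeff_msupp mcoeff_map_mpoly /= => h; apply: hs.
by rewrite mcoeff_msupp; apply: contraNneq h => ->; rewrite rmorph0.
Qed.

Lemma section_valueZ c (A : 'M[L]_(d.+1, e.+1)) :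
  section_value phi s (c *: A) = c ^+ n * section_value phi s A.
Proof. by apply: (meval_homog map_homog) => i; rewrite linearZ mxE. Qed.

(** The remaining torus weights are positive, so the torus moves A to 0 as t tends to 0, while s is
    constant along the orbit and vanishes at 0. *)
Lemma unstable_section_value (A : 'M[L]_(d.+1, e.+1)) :
  (forall (i : 'I_d.+1) (j : 'I_e.+1), (2 * (i + j) < d + e)%N -> A i j = 0) ->
  section_value phi s A = 0.
Proof.
move=> hA.
(* The action of diag(t^-1, t) on A. Where subtraction truncates the exponent, the entry of A is
   zero. *)
pose B : 'M[{poly L}]_(d.+1, e.+1) :=
  \matrix_(i, j) (A i j *: 'X^(2 * (i + j) - (d + e))).
pose P := section_value (@polyC L \o phi) s B.
have PE t : P.[t] = section_value phi s (map_mx (horner_eval t) B).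
  rewrite -[LHS]/(horner_eval t P) rmorph_section_value; apply: eq_section_value => c.
  by rewrite /= horner_evalE hornerC.
have mapB t : map_mx (horner_eval t) B = \matrix_(i, j) (A i j * t ^+ (2 * (i + j) - (d + e))).
  by apply/matrixP => i j; rewrite !mxE horner_evalE hornerZ hornerXn.
have P0 : P.[0] = 0.
  rewrite PE mapB (_ : \matrix_(i, j) _ = 0 *: A).
    by rewrite section_valueZ expr0n gtn_eqF ?mul0r.
  apply/matrixP => i j; rewrite !mxE mul0r expr0n.
  have [/hA ->|hij] := ltnP (2 * (i + j))%N (d + e); first by rewrite mul0r.
  (* Oddness of d + e excludes the exponent zero. *)
  by rewrite gtn_eqF ?mulr0// subn_gt0; lia.
have Pt t : t != 0 -> P.[t] = section_value phi s A.
  move=> t0; rewrite PE -(@section_value_conj_act (diag2 t^-1 t) A); last first.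
    by rewrite det_mx2 !mxE /= !mulr1n !mulr0n mul0r subr0 mulVf.
  congr section_value; rewrite mapB; apply/matrixP => i j; rewrite conj_act_diag2 mxE.
  have [/hA ->|hij] := ltnP (2 * (i + j))%N (d + e); first by rewrite mul0r mulr0.
  rewrite mulrC; congr (_ * _); rewrite mulrACA -!exprD exprVn.
  apply: (mulfI (expf_neq0 (d - i + (e - j)) t0)); rewrite mulrA mulfV ?expf_neq0// mul1r -exprD.
  by congr (_ ^+ _); have := ltn_ord i; have := ltn_ord j; lia.
suff PC : P - (section_value phi s A)%:P = 0.
  by have := congr1 (horner^~ 0) PC; rewrite !hornerE P0 sub0r => /eqP; rewrite oppr_eq0 => /eqP.
apply: (poly_eq0_nat hL) => m; rewrite /root !hornerE Pt ?subrr//.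
by have /pcharf0P -> := hL.
Qed.

Variable f : 'M[L]_(d.+1, e.+1).
Hypothesis sf : section_value phi s f != 0.

(** The entries of negative torus weight. *)
Let low (u : 'I_d.+1 * 'I_e.+1) := (2 * (u.1 + u.2) < d + e)%N.

(** By [unstable_section_value], a common zero z of the low entries would make s vanish on the orbit
    of f. *)
Lemma shear_bezout : exists a : 'I_d.+1 * 'I_e.+1 -> {poly L}, forall z,
  \sum_(u | low u) (a u).[z] * conj_act (mat2 1 0 z 1) f u.1 u.2 = 1.
Proof.
(* The other entries are replaced by 0, since [bezout_family] runs over the whole index type. *)
pose P (u : 'I_d.+1 * 'I_e.+1) :=
  if low u then conj_act (mat2 1 0 'X 1) (map_mx polyC f) u.1 u.2 else 0.
have PE u z : (P u).[z] = if low u then conj_act (mat2 1 0 z 1) f u.1 u.2 else 0.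
  rewrite /P; case: (low u); last by rewrite horner0.
  have hg : map_mx (horner_eval z) (mat2 1 0 'X 1) = mat2 1 0 z 1.
    apply/matrixP => i j; rewrite !mxE.
    by case: (i == 0); case: (j == 0); rewrite /= /horner_eval ?hornerE.
  have hf : map_mx (horner_eval z) (map_mx polyC f) = f.
    by apply/matrixP => i j; rewrite !mxE /= /horner_eval hornerC.
  have := map_conj_act (horner_eval z) (mat2 1 0 'X 1) (map_mx polyC f).
  by rewrite hg hf => <-; rewrite [RHS]mxE.
have [z|a ha] := @bezout_family L _ P.
  apply/existsP; apply: contraNT sf => /existsPn Pz.
  have dz : \det (mat2 1 0 z 1) = 1 :> L by rewrite det_mx2 !mxE /= mul0r subr0 mulr1.
  rewrite -(section_value_conj_act f dz) unstable_section_value// => i j hij.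
  by have /negPn/eqP := Pz (i, j); rewrite PE /low /= hij.
exists a => z; have := congr1 (horner^~ z) ha; rewrite /= hornerC horner_sum => haz.
rewrite -[RHS]haz.
rewrite [RHS](bigID low) /= [X in _ = _ + X]big1 ?addr0 => [|u /negPf hu].
  by apply: eq_bigr => u hu; rewrite hornerM PE hu.
by rewrite hornerM PE hu mulr0.
Qed.

(** This is the Bezout identity at z = g10 / g00, multiplied by g00^(N+1). The shear by z times
    diag(g00, 1) equals g times the matrix on the right, so the low entries of f o shear are those
    of the right side up to powers of g00. *)
Lemma first_entry_relation : exists N (a : 'I_d.+1 * 'I_e.+1 -> {poly L}), [/\
  forall u, (d + e + size (a u) <= N)%N &
  forall g : 'M[L]_2, \det g = 1 -> g 0 0 ^+ N.+1 =
    \sum_(u | low u)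
      (\sum_(l < size (a u)) (a u)`_l * (g 1 0 ^+ l * g 0 0 ^+ (N.+1 - (d - u.1 + (e - u.2)) - l)))
      * conj_act (mat2 1 (- g 0 1) 0 (g 0 0)) (conj_act g f) u.1 u.2].
Proof.
have [a ha] := shear_bezout.
(* Large enough for the subtractions in the exponents to be exact and for every exponent of g00 to
   be positive. *)
pose N := (d + e + \sum_u size (a u))%N; exists N, a.
have sa u : (d + e + size (a u) <= N)%N by rewrite leq_add2l (bigD1 u)//= leq_addr.
split => // g dg; rewrite -{}conj_actM.
(* If g00 = 0, then z is undefined, but both sides vanish. *)
have [x0|x0] := eqVneq (g 0 0) 0.
  rewrite {1}x0 expr0n big1//= => u _; rewrite big1 ?mul0r// => l _.
  rewrite x0 expr0n gtn_eqF ?mulr0//.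
  move: (ltn_ord l) (sa u); move: (nat_of_ord l) => l0; move: (size (a u)) => S0.
  by clear; clearbody N; lia.
pose x := g 0 0; pose z := g 1 0 / x.
have -> : g *m mat2 1 (- g 0 1) 0 x = mat2 1 0 z 1 *m diag2 x 1.
  move: dg; rewrite det_mx2 => dg.
  apply/matrixP => i j; rewrite !mxE !sum_ord2 !mxE.
  case: (ord2P i) => ->; case: (ord2P j) => ->; rewrite /= ?mulr1n ?mulr0n /z /x.
  - by ring.
  - by ring.
  - by field.
  - by rewrite mulr0 mulr1 add0r -dg; ring.
transitivity (\sum_(u | low u) x ^+ N.+1 * ((a u).[z] * conj_act (mat2 1 0 z 1) f u.1 u.2)).
  by rewrite -mulr_sumr ha mulr1.
apply: eq_bigr => u _; rewrite conj_actM conj_act_diag2 !expr1n !mulr1.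
have -> : g 1 0 = z * x by rewrite /z divfK.
rewrite horner_coef -exprD !mulrA; congr (_ * _); rewrite mulr_sumr mulr_suml.
apply: eq_bigr => l _; rewrite [(z * x) ^+ l]exprMn.
have -> : N.+1 = (l + (N.+1 - (d - u.1 + (e - u.2)) - l) + (d - u.1 + (e - u.2)))%N.
  move: (ltn_ord l) (sa u); move: (nat_of_ord l) => l0; move: (size (a u)) => S0.
  by clear; clearbody N; lia.
rewrite {1}exprD [x ^+ (l + _)]exprD.
set D := (d - u.1 + (e - u.2))%N.
rewrite (_ : (l + (N.+1 - D - l) + D - D - l)%N = (N.+1 - D - l)%N); last first.
  by lia.
by rewrite /x; ring.
Qed.

End Instability.

(** * Finiteness of the orbit map *)

Section IntegralExtension.
Variables (L : closedFieldType) (hL : [pchar L] =i pred0) (T : Type).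

Definition integral_over (R : comNzRingType) (ev : T -> {rmorphism R -> L}) (x : T -> L) :=
  exists q : {poly R}, [/\ q \is monic, (1 < size q)%N & forall t, ext_ev (ev t) (x t) q = 0].

Lemma integral_over_ext (R : comNzRingType) (ev : T -> {rmorphism R -> L}) (x z : T -> L) :
  integral_over ev x -> integral_over (fun t => ext_ev (ev t) (z t)) x.
Proof.
move=> [q [qm q1 hq]]; exists (map_poly polyC q); rewrite size_map_polyC; split=> // [|t].
  exact: monic_map.
rewrite -(hq t) /ext_ev /= -map_poly_comp; congr (horner_eval _ _).
by apply: eq_map_poly => c; rewrite /= map_polyC /horner_eval hornerC.
Qed.

Lemma specializes_integral (R : comNzRingType) (ev : T -> {rmorphism R -> L}) phi (x : T -> L) :
  integral_over ev x -> specializes ev phi ->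
  exists y, specializes (fun t => ext_ev (ev t) (x t)) (ext_ev phi y).
Proof. by move=> [q [qm q1 hq]] sp; apply: specializes_monic hq. Qed.

End IntegralExtension.

Section Orbit.
Variables (k : fieldType) (L : closedFieldType) (phi : {rmorphism k -> L}).
Variables (hL : [pchar L] =i pred0) (d e n : nat) (s : coord_ring k d e).
Hypotheses (de_odd : odd (d + e)) (n_gt0 : (0 < n)%N) (s_inv : invariant_section n s).
Variable f : 'M[L]_(d.+1, e.+1).
Hypothesis sf : section_value phi s f != 0.

Let T := {g : 'M[L]_2 | \det g = 1}.
Let R := coord_ring L d e.
Definition point_ev (A : 'M[L]_(d.+1, e.+1)) : {rmorphism R -> L} := meval (mxvec A 0).
(** The orbit map g |-> f o g on points; its finiteness is the integrality of the entries of g over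
    [R] through [ev]. *)
Let ev (t : T) := point_ev (conj_act (sval t) f).
Let x (t : T) : 'I_(2 * 2) -> L := mxvec (sval t) 0.
Definition generic_form : 'M[R]_(d.+1, e.+1) := vec_mx (\row_i 'X_i).

Lemma map_point_ev_generic_form A : map_mx (point_ev A) generic_form = A.
Proof.
rewrite map_vec_mx -[RHS]mxvecK; congr vec_mx; apply/rowP => i.
by rewrite !mxE /= mevalXU.
Qed.

Lemma point_evC A c : point_ev A c%:MP = c.
Proof. exact: mevalC. Qed.

Let degree_le_scale m c F : degree_le ev x m F -> degree_le ev x m (fun t => c * F t).
Proof.
by move=> hF; apply: eq_degree_le (degree_leZ c%:MP hF) => t; rewrite point_evC.
Qed.

Let degree_le_entry i j : degree_le ev x 1 (fun t => sval t i j).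
Proof.
by apply: eq_degree_le (degree_le_var _ _ (mxvec_index i j)) => t; rewrite /x mxvecE.
Qed.

Let degree_le_mul (h l : 'M[L]_2) i j : degree_le ev x 1 (fun t => (h *m sval t *m l) i j).
Proof.
have E (t : T) : \sum_(b < 2) \sum_(a < 2) (h i a * l b j) * sval t a b = (h *m sval t *m l) i j.
  rewrite mxE; apply: eq_bigr => b _; rewrite mxE mulr_suml.
  by apply: eq_bigr => a _; ring.
apply: (eq_degree_le E); apply: degree_le_sum => b _; apply: degree_le_sum => a _.
exact: degree_le_scale.
Qed.

(** Multiplication by the Weyl element on either side moves any entry to the corner, where
    [first_entry_relation] applies. *)
Lemma entry_to_corner i j : exists h h' l : 'M[L]_2,
  [/\ \det h = 1, \det h' = 1, \det l = 1, h' *m h = 1%:M &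
      forall g, (h *m g *m l) 0 0 = g i j].
Proof.
pose w : 'M[L]_2 := mat2 0 1 (-1) 0; pose w' : 'M[L]_2 := mat2 0 (-1) 1 0.
have dw : \det w = 1 by rewrite det_mx2 !mxE /=; ring.
have dw' : \det w' = 1 by rewrite det_mx2 !mxE /=; ring.
have ww' : w' *m w = 1%:M.
  apply/matrixP => a b; rewrite !mxE sum_ord2 !mxE.
  by case: (ord2P a) => ->; case: (ord2P b) => ->; rewrite /=; ring.
exists (if i == 0 then 1%:M else w), (if i == 0 then 1%:M else w'), (if j == 0 then 1%:M else w').
split; try by case: ifP => _ //; rewrite det1.
  by case: ifP => _ //; rewrite mul1mx.
move=> g; case: (ord2P i) => ->; case: (ord2P j) => -> /=; rewrite ?mul1mx ?mulmx1 //.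
all: by rewrite !mxE !sum_ord2 ?mxE ?sum_ord2 ?mxE /=; ring.
Qed.

(** [first_entry_relation] is applied to h g l and f o h', for which (f o h') o (h g l) = (f o g) o
    l has coefficients coming from [R]. *)
Lemma entry_relation i j : exists N, degree_le ev x N (fun t => sval t i j ^+ N.+1).
Proof.
have [h [h' [l [dh dh' dl hh' ij]]]] := entry_to_corner i j.
have sf' : section_value phi s (conj_act h' f) != 0 by rewrite (section_value_conj_act phi s_inv).
have [N [a [sa rel]]] := first_entry_relation hL de_odd n_gt0 s_inv sf'.
exists N; pose g' (t : T) := h *m sval t *m l.
have dg' t : \det (g' t) = 1 by rewrite !det_mulmx dh dl (svalP t) !mulr1.
have cg' t : conj_act (g' t) (conj_act h' f) = conj_act l (map_mx (ev t) generic_form).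
  by rewrite map_point_ev_generic_form -!conj_actM !mulmxA hh' mul1mx.
have gE (t : T) := etrans (esym (rel (g' t) (dg' t)))
  (congr1 (fun y => y ^+ N.+1) (ij (sval t))).
apply: (eq_degree_le gE).
apply: degree_le_sum => u hu.
(* The total degree N + 1 - (d + e) + 2 (i + j) is at most N because (i, j) is low. *)
apply: (@degree_leW _ _ _ _ _ _ ((N.+1 - (d - u.1 + (e - u.2))) + (u.1 + u.2))).
  move: hu (sa u) (ltn_ord u.1) (ltn_ord u.2).
  by move: (nat_of_ord u.1) (nat_of_ord u.2) (size (a u)) => u1 u2 S0; clear; lia.
apply: degree_leM.
  apply: degree_le_sum => m _; apply: degree_le_scale.
  apply: (@degree_leW _ _ _ _ _ _ (1 * m + 1 * (N.+1 - (d - u.1 + (e - u.2)) - m))).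
    by move: (ltn_ord m) (sa u); move: (nat_of_ord m) => m0; move: (size (a u)) => S0; clear; lia.
  by apply: degree_leM; apply: degree_leX; apply: degree_le_mul.
(* The first column of the combined matrix is that of [l], hence constant; the second is linear in
   g. *)
apply: (@eq_degree_le _ _ _ _ _ _ _ (fun t => conj_act (l *m mat2 1 (- g' t 0 1) 0 (g' t 0 0))
    (map_mx (ev t) generic_form) u.1 u.2)).
  by move=> t; rewrite cg' conj_actM.
apply: degree_le_conj_act => b.
  by exists (l b 0)%:MP => t; rewrite mxE sum_ord2 !mxE /= point_evC; ring.
apply: (@eq_degree_le _ _ _ _ _ _ _ (fun t => (- l b 0) * g' t 0 1 + l b 1 * g' t 0 0)).
  move=> t; move: (g' t) => g0.
  by rewrite mxE sum_ord2 [mat2 _ _ _ _ 0 1]mxE [mat2 _ _ _ _ 1 1]mxE /=; ring.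
by apply: degree_leD; apply: degree_le_scale; apply: degree_le_mul.
Qed.

Lemma integral_over_entry i j : integral_over ev (fun t => sval t i j).
Proof.
have /fin_all_exists [Ns hNs] (u : 'I_2 * 'I_2) := entry_relation u.1 u.2.
(* [integral_of_degree_le] needs one N for all four entries; smaller exponents are padded by powers
   of the entry. *)
pose N := (\sum_u Ns u)%N.
have hN i' : degree_le ev x N (fun t => x t i' ^+ N.+1).
  case/mxvec_indexP: i' => a b.
  have le_N : (Ns (a, b) <= N)%N by rewrite /N (bigD1 (a, b))//= leq_addr.
  apply: (@eq_degree_le _ _ _ _ _ _ _
    (fun t : T => sval t a b ^+ (N - Ns (a, b)) * sval t a b ^+ (Ns (a, b)).+1)).
    by move=> t; rewrite -exprD /x mxvecE addnS subnK.
  apply: degree_leW (degree_leM (degree_leX (N - Ns (a, b)) (degree_le_entry a b)) (hNs (a, b))).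
  by rewrite mul1n subnK.
have [q [qm q1 hq]] := integral_of_degree_le hN (mxvec_index i j).
by exists q; split=> // t; have := hq t; rewrite /x mxvecE => /eqP <-.
Qed.

Lemma finite_roots (p : {poly L}) : p != 0 -> exists xs : seq L, forall y, root p y -> y \in xs.
Proof.
move=> p0; have [xs pE] := closed_field_poly_normal p; exists xs => y.
by rewrite pE rootZ ?lead_coef_eq0// root_prod_XsubC.
Qed.

(** If f o g = c f, invariance and homogeneity force c^n = 1. For each of these finitely many c, the
    entries of g are roots of fixed monic polynomials specialized at c f. *)
Lemma finite_stabilizer_semistable : finite_stabilizer f.
Proof.
have /fin_all_exists [q hq] (u : 'I_2 * 'I_2) : exists q : {poly R}, q \is monic /\
    forall t : T, ext_ev (ev t) (sval t u.1 u.2) q = 0.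
  by have [q [qm _ hq]] := integral_over_entry u.1 u.2; exists q.
have [cs hcs] : exists cs : seq L, forall c, c ^+ n = 1 -> c \in cs.
  have [|cs hcs] := @finite_roots ('X^n - 1%:P); first by rewrite -size_poly_eq0 size_XnsubC.
  by exists cs => c hc; apply: hcs; rewrite /root !hornerE hc subrr.
have /boolp.choice [rts hrts] (v : L * ('I_2 * 'I_2)) : exists xs : seq L, forall y,
    root (map_poly (point_ev (v.1 *: f)) (q v.2)) y -> y \in xs.
  by apply: finite_roots; rewrite monic_neq0// monic_map//; case: (hq v.2).
pose E := flatten [seq rts (c, u) | c <- cs, u <- enum {: 'I_2 * 'I_2}].
exists [seq mat2 p.1.1 p.1.2 p.2.1 p.2.2 | p <- [seq (p1, p2) |
  p1 <- [seq (a, b) | a <- E, b <- E], p2 <- [seq (a, b) | a <- E, b <- E]]].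
move=> g [dg [c c0 gc]]; have cn : c ^+ n = 1.
  apply: (mulIf sf); rewrite -(section_valueZ phi s_inv) -gc mul1r.
  exact: (section_value_conj_act phi s_inv f dg).
have gE i j : g i j \in E.
  apply/flattenP; exists (rts (c, (i, j))).
    by apply/allpairsP; exists (c, (i, j)); split; rewrite ?mem_enum /= ?hcs.
  apply: hrts; have [_ /(_ (exist _ g dg))/eqP] := hq (i, j).
  by rewrite /ext_ev /ev /= gc.
apply/mapP; exists ((g 0 0, g 0 1), (g 1 0, g 1 1)); first by rewrite !allpairs_f.
apply/matrixP => i j; rewrite mxE /=.
by case: (ord2P i) => ->; case: (ord2P j) => ->.
Qed.

(** The equations det g = 1 and f o g = B are polynomial in the entries of g and B, so they pass to
    the specialization. *)
Lemma specializes_generic_form (S : comNzRingType) (evS : T -> {rmorphism S -> L})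
    (phiS : {rmorphism S -> L}) (cst : {rmorphism R -> S}) (G : 'M[S]_2) (B : 'M[L]_(d.+1, e.+1)) :
    specializes evS phiS -> (forall t, map_mx (evS t) G = sval t) ->
    (forall t r, evS t (cst r) = ev t r) -> (forall r, phiS (cst r) = point_ev B r) ->
  \det (map_mx phiS G) = 1 /\ conj_act (map_mx phiS G) f = B.
Proof.
move=> sp evG ev_cst phi_cst; split.
  have : phiS (\det G - 1) = 0.
    by apply: sp => t; rewrite rmorphB rmorph1 -det_map_mx evG (svalP t) subrr.
  by rewrite rmorphB rmorph1 -det_map_mx => /eqP; rewrite subr_eq0 => /eqP.
pose fS := map_mx cst (map_mx (@mpolyC _ L) f).
have ev_fS t : map_mx (evS t) fS = f.
  by apply/matrixP => i j; rewrite !mxE ev_cst point_evC.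
have phi_fS : map_mx phiS fS = f.
  by apply/matrixP => i j; rewrite !mxE phi_cst point_evC.
pose D := conj_act G fS - map_mx cst generic_form.
have DE (h : {rmorphism S -> L}) : map_mx h D =
    conj_act (map_mx h G) (map_mx h fS) - map_mx (h \o cst) generic_form.
  by rewrite map_mxB map_conj_act; congr (_ - _); apply/matrixP => i j; rewrite !mxE.
have : map_mx phiS D = 0.
  apply/matrixP => i j; rewrite [LHS]mxE sp ?[RHS]mxE// => t.
  have : map_mx (evS t) D = 0.
    by rewrite DE evG ev_fS (eq_map_mx _ (ev_cst t)) map_point_ev_generic_form subrr.
  by move=> /matrixP/(_ i j); rewrite [LHS]mxE [RHS]mxE.
rewrite DE phi_fS (eq_map_mx _ phi_cst) map_point_ev_generic_form => /eqP.
by rewrite subr_eq0 => /eqP.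
Qed.

(** Lying over: the four entries of g are adjoined one at a time, and integrality lifts the
    specialization at each step. The lifted entries form the required g. *)
Lemma specializes_orbit_mem (B : 'M[L]_(d.+1, e.+1)) : specializes ev (point_ev B) ->
  exists2 g : 'M[L]_2, \det g = 1 & conj_act g f = B.
Proof.
move=> sp0.
have [y1 sp1] := specializes_integral hL (integral_over_entry 0 0) sp0.
have int2 := integral_over_ext (fun t : T => sval t 0 0) (integral_over_entry 0 1).
have [y2 sp2] := specializes_integral hL int2 sp1.
have int3 := integral_over_ext (fun t : T => sval t 0 1)
  (integral_over_ext (fun t : T => sval t 0 0) (integral_over_entry 1 0)).
have [y3 sp3] := specializes_integral hL int3 sp2.
have int4 := integral_over_ext (fun t : T => sval t 1 0)
  (integral_over_ext (fun t : T => sval t 0 1)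
  (integral_over_ext (fun t : T => sval t 0 0) (integral_over_entry 1 1))).
have [y4 sp4] := specializes_integral hL int4 sp3.
pose ev4 (t : T) := ext_ev (ext_ev (ext_ev (ext_ev (ev t) (sval t 0 0)) (sval t 0 1))
  (sval t 1 0)) (sval t 1 1).
pose phi4 := ext_ev (ext_ev (ext_ev (ext_ev (point_ev B) y1) y2) y3) y4.
have {}sp4 : specializes ev4 phi4 := sp4.
pose R4 := {poly {poly {poly {poly R}}}}.
pose cst : {rmorphism R -> R4} := polyC \o (polyC \o (polyC \o polyC)).
pose G : 'M[R4]_2 := mat2 'X%:P%:P%:P 'X%:P%:P 'X%:P 'X.
have evG t : map_mx (ev4 t) G = sval t.
  apply/matrixP => i j; rewrite !mxE.
  by case: (ord2P i) => ->; case: (ord2P j) => ->; rewrite /ev4 !(ext_evC, ext_evX).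
have ev_cst t r : ev4 t (cst r) = ev t r by rewrite -[cst r]/(r%:P%:P%:P%:P) /ev4 !ext_evC.
have phi_cst r : phi4 (cst r) = point_ev B r by rewrite -[cst r]/(r%:P%:P%:P%:P) /phi4 !ext_evC.
have [dG GB] := specializes_generic_form sp4 evG ev_cst phi_cst.
by exists (map_mx phi4 G).
Qed.

Lemma point_evZ m (F : R) c A : F \is m.-homog -> point_ev (c *: A) F = c ^+ m * point_ev A F.
Proof. by move=> hF; apply: (meval_homog hF) => i; rewrite linearZ mxE. Qed.

Lemma point_ev_homog_parts (F : R) c A :
  point_ev (c *: A) F = \sum_(m < msize F) c ^+ m * point_ev A (pihomog mdeg m F).
Proof.
rewrite {1}(pihomog_partitionE (leqnn (msize F))) rmorph_sum; apply: eq_bigr => m _.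
exact/point_evZ/pihomogP.
Qed.

Let scaled_ev (t : T * L) := point_ev (t.2 *: conj_act (sval t.1) f).

(* The scalar t.2 is an extra coordinate making the orbit a cone, so that homogeneous equations
   suffice; it is specialized first and then divided out. *)
Lemma specializes_scaled_orbit B :
    (forall F m, F \is m.-homog -> (forall t, ev t F = 0) -> point_ev B F = 0) ->
  specializes scaled_ev (point_ev B).
Proof.
move=> hB F hF; rewrite -[B]scale1r point_ev_homog_parts big1// => m _.
rewrite (hB _ m) ?mulr0 ?pihomogP// => t.
(* On the multiples of f o g, F is a polynomial in the scale that vanishes at all positive integers;
   its coefficients are the values of the homogeneous parts. *)
have Q0 : \poly_(l < msize F) ev t (pihomog mdeg l F) = 0.
  apply: (poly_eq0_nat hL) => c; rewrite /root horner_poly -[X in _ == X](hF (t, c.+1%:R)).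
  by rewrite /scaled_ev point_ev_homog_parts; apply/eqP/eq_bigr => l _; rewrite mulrC.
by have := congr1 (fun p : {poly L} => p`_m) Q0; rewrite coef_poly ltn_ord coef0.
Qed.

(** The extra variable stands for the scale: evaluation at (c A, c) gives a power of c times F(A),
    without dividing by c. *)
Definition homogenized (F : R) : {poly R} :=
  \sum_(m < msize F) (pihomog mdeg m F)%:P * 'X^(msize F - m).

Lemma ext_ev_homogenized F c A :
  ext_ev (point_ev (c *: A)) c (homogenized F) = c ^+ msize F * point_ev A F.
Proof.
rewrite -[A in RHS]scale1r point_ev_homog_parts rmorph_sum mulr_sumr; apply: eq_bigr => m _.
rewrite expr1n mul1r rmorphM rmorphXn ext_evC ext_evX (@point_evZ m) ?pihomogP//.
by rewrite mulrAC -exprD subnKC// ltnW.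
Qed.

Lemma specializes_unscale B c : c != 0 ->
    specializes (fun t => ext_ev (scaled_ev t) t.2) (ext_ev (point_ev B) c) ->
  specializes ev (point_ev (c^-1 *: B)).
Proof.
move=> c0 sp F hF; apply: (mulfI (expf_neq0 (msize F) c0)).
rewrite -ext_ev_homogenized scalerA mulfV// scale1r mulr0; apply: sp => t.
by rewrite /scaled_ev ext_ev_homogenized hF mulr0.
Qed.

Lemma section_value_point_ev A : section_value phi s A = point_ev A (map_mpoly phi s).
Proof. by []. Qed.

(** The equations are all homogeneous F vanishing on the orbit. A solution B lifts first to a scale
    and then to a group element, both being integral. *)
Lemma zariski_closed_orbit :
  zariski_closed_in (fun B => section_value phi s B != 0) (same_orbit f).
Proof.
exists (fun F => (exists m, F \is m.-homog) /\ forall t, ev t F = 0).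
split=> [F []//|B B0 sB]; split=> [[g [c [dg c0 ->]]] F [[m Fm] hF]|hB].
  by rewrite -[LHS]/(point_ev _ F) (point_evZ _ _ Fm) (hF (exist _ g dg)) mulr0.
have sp : specializes scaled_ev (point_ev B).
  by apply: specializes_scaled_orbit => F m Fm hF; apply: hB; split=> //; exists m.
(* The scale c satisfies c^n = s(B) / s(f), so it is integral over [R], and nonzero because s(B)
   is. *)
pose q : {poly R} := 'X^n - ((section_value phi s f)^-1 *: map_mpoly phi s)%:P.
have qE A c : ext_ev (point_ev A) c q = c ^+ n - section_value phi s A / section_value phi s f.
  rewrite rmorphB rmorphXn ext_evX ext_evC -mul_mpolyC rmorphM point_evC.
  by rewrite -section_value_point_ev [in RHS]mulrC.
have q0 t : ext_ev (scaled_ev t) t.2 q = 0.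
  rewrite qE (section_valueZ phi s_inv) (section_value_conj_act phi s_inv) ?(svalP t.1)//.
  by rewrite mulfK// subrr.
have Xint : integral_over scaled_ev snd.
  by exists q; rewrite monicXnsubC// size_XnsubC.
have [c spc] := specializes_integral hL Xint sp.
have cn : c ^+ n = section_value phi s B / section_value phi s f.
  by apply/eqP; rewrite -subr_eq0 -qE; apply/eqP/spc.
have c0 : c != 0.
  apply: contraTneq (mulf_neq0 sB (invr_neq0 sf)) => c0.
  by rewrite -cn c0 expr0n gtn_eqF// eqxx.
have [g dg gB] := specializes_orbit_mem (specializes_unscale c0 spc).
by exists g, c; split=> //; rewrite gB scalerA mulfV// scale1r.
Qed.

End Orbit.

(** * Algebraically closed extensions *)

Section Ultrafilter.
Variable T : eqType.

(** The sets containing all s above some s0 form a proper filter, as two bounds s0 can be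
    concatenated; an ultrafilter refines it. *)
Lemma cofinal_ultrafilter : exists G : (seq T -> Prop) -> Prop,
  [/\ ~ G (fun=> False),
      forall A B, G A -> G B -> G (fun s => A s /\ B s),
      forall A B : seq T -> Prop, (forall s, A s -> B s) -> G A -> G B,
      forall A, G A \/ G (fun s => ~ A s) &
      forall x, G (fun s => x \in s)].
Proof.
pose F (A : seq T -> Prop) := exists s0 : seq T, forall s, {subset s0 <= s} -> A s.
have FF : filter.ProperFilter F.
  split; first by move=> [s /(_ s)]; apply.
  split; first by exists [::].
  - move=> A B [s hs] [s' hs']; exists (s ++ s') => r hr; split.
      by apply: hs => x xs; apply: hr; rewrite mem_cat xs.
    by apply: hs' => x xs; apply: hr; rewrite mem_cat xs orbT.
  - by move=> A B AB [s hs]; exists s => r /hs/AB.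
have [G [UG FG]] := filter.ultraFilterLemma FF; exists G.
have GF := @filter.ultra_proper _ _ UG; have GF' := @filter.filter_filter _ _ GF.
split.
- exact: (filter.filter_not_empty G).
- exact: filter.filterI.
- by move=> A B AB; apply: filter.filterS.
- by move=> A; apply: filter.in_ultra_setVsetC.
- by move=> x; apply: FG; exists [:: x] => s; apply; rewrite mem_head.
Qed.
End Ultrafilter.

Section GeneratedSubfield.
Variables (k : fieldType) (s : seq k).

(** Terms over the generators make the generated subfield countable, as
    [countable_algebraic_closure] requires. The operations are those of [divring_closed]. *)
Fixpoint field_term (t : GenTree.tree nat) : k :=
  match t with
  | GenTree.Leaf i => s`_i
  | GenTree.Node 0 [:: a; b] => field_term a - field_term b
  | GenTree.Node 1 [:: a; b] => field_term a / field_term b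
  | _ => 1
  end.

Definition generated : {pred k} := fun x => boolp.asbool (exists t, field_term t = x).

Lemma generated_divring_closed : divring_closed generated.
Proof.
have genP x y : x \in generated -> y \in generated ->
    exists a b, x = field_term a /\ y = field_term b.
  by move=> /boolp.asboolP[a <-] /boolp.asboolP[b <-]; exists a, b.
split=> [|x y hx hy|x y hx hy]; try have [a [b [-> ->]]] := genP x y hx hy.
- by apply/boolp.asboolP; exists (GenTree.Node 2 [::]).
- by apply/boolp.asboolP; exists (GenTree.Node 0 [:: a; b]).
- by apply/boolp.asboolP; exists (GenTree.Node 1 [:: a; b]).
Qed.

HB.instance Definition _ := GRing.isDivringClosed.Build k generated generated_divring_closed.

Record genfield := GenField { gen_val : k; gen_valP : gen_val \in generated }.
HB.instance Definition _ := [isSub for gen_val].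
HB.instance Definition _ := [Choice of genfield by <:].
HB.instance Definition _ := [SubChoice_isSubComUnitRing of genfield by <:].
HB.instance Definition _ := [SubComUnitRing_isSubIntegralDomain of genfield by <:].
HB.instance Definition _ := [SubIntegralDomain_isSubField of genfield by <:].

Definition gen_code (x : genfield) : GenTree.tree nat :=
  sval (boolp.cid (boolp.asboolP _ (gen_valP x))).

Lemma gen_codeK : pcancel gen_code (fun t => insub (field_term t)).
Proof.
move=> x; rewrite /gen_code; case: boolp.cid => t /= ->.
by rewrite -[gen_val x]/(val x) valK.
Qed.

HB.instance Definition _ := PCanIsCountable gen_codeK.

End GeneratedSubfield.
Lemma mem_generated (k : fieldType) (s : seq k) x : x \in s -> x \in generated s.
Proof.
by move=> xs; apply/boolp.asboolP; exists (GenTree.Leaf (index x s)); rewrite /= nth_index.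
Qed.

Section Ultraproduct.
Variables (I : Type) (G : (I -> Prop) -> Prop) (K : I -> closedFieldType).
Hypotheses (G0 : ~ G (fun=> False)) (GI : forall A B, G A -> G B -> G (fun i => A i /\ B i)).
Hypotheses (GS : forall A B : I -> Prop, (forall i, A i -> B i) -> G A -> G B).
Hypothesis GC : forall A, G A \/ G (fun i => ~ A i).

Lemma ultraT : G (fun=> True).
Proof. by case: (GC (fun=> True)) => h; apply: GS h. Qed.

Definition prodfield := forall i, K i.
HB.instance Definition _ := boolp.gen_eqMixin prodfield.
HB.instance Definition _ := boolp.gen_choiceMixin prodfield.

Definition prodfield_add (x y : prodfield) : prodfield := fun i => x i + y i.
Definition prodfield_mul (x y : prodfield) : prodfield := fun i => x i * y i.
Definition prodfield_opp (x : prodfield) : prodfield := fun i => - x i.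

Lemma prodfield_ext (x y : prodfield) : (forall i, x i = y i) -> x = y.
Proof. exact: boolp.functional_extensionality_dep. Qed.

Fact prodfield_addA : associative prodfield_add.
Proof. by move=> x y z; apply: prodfield_ext => i; rewrite /prodfield_add addrA. Qed.
Fact prodfield_addC : commutative prodfield_add.
Proof. by move=> x y; apply: prodfield_ext => i; rewrite /prodfield_add addrC. Qed.
Fact prodfield_add0 : left_id ((fun=> 0) : prodfield) prodfield_add.
Proof. by move=> x; apply: prodfield_ext => i; rewrite /prodfield_add add0r. Qed.
Fact prodfield_addN : left_inverse ((fun=> 0) : prodfield) prodfield_opp prodfield_add.
Proof. by move=> x; apply: prodfield_ext => i; rewrite /prodfield_add /prodfield_opp addNr. Qed.
HB.instance Definition _ := GRing.isZmodule.Build prodfield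
  prodfield_addA prodfield_addC prodfield_add0 prodfield_addN.

Fact prodfield_mulA : associative prodfield_mul.
Proof. by move=> x y z; apply: prodfield_ext => i; rewrite /prodfield_mul mulrA. Qed.
Fact prodfield_mulC : commutative prodfield_mul.
Proof. by move=> x y; apply: prodfield_ext => i; rewrite /prodfield_mul mulrC. Qed.
Fact prodfield_mul1 : left_id ((fun=> 1) : prodfield) prodfield_mul.
Proof. by move=> x; apply: prodfield_ext => i; rewrite /prodfield_mul mul1r. Qed.
Fact prodfield_mulD : left_distributive prodfield_mul +%R.
Proof. by move=> x y z; apply: prodfield_ext => i; rewrite -[LHS]/((x i + y i) * z i) mulrDl. Qed.
Fact prodfield_neq0 : ((fun=> 1) : prodfield) != 0.
Proof.
apply/eqP => E; apply: G0; apply: GS ultraT => i _.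
have /eqP := congr1 (fun x : prodfield => x i) E.
by rewrite -[X in _ == X]/(0 : K i) oner_eq0.
Qed.
HB.instance Definition _ := GRing.Zmodule_isComNzRing.Build prodfield
  prodfield_mulA prodfield_mulC prodfield_mul1 prodfield_mulD prodfield_neq0.

Definition null : {pred prodfield} := fun x => boolp.asbool (G (fun i => x i = 0)).

Lemma nullP x : reflect (G (fun i => x i = 0)) (x \in null).
Proof. exact: boolp.asboolP. Qed.

Lemma null_idealr_closed : idealr_closed null.
Proof.
split.
- by apply/nullP; apply: GS ultraT.
- apply/nullP => h; apply: G0; apply: GS h => i /eqP.
  by rewrite -[X in X == _]/(1 : K i) oner_eq0.
- move=> a x y /nullP hx /nullP hy; apply/nullP; apply: GS (GI hx hy) => i [xi yi].
  by rewrite -[LHS]/(a i * x i + y i) xi yi mulr0 addr0.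
Qed.
HB.instance Definition _ := isIdealr.Build prodfield null null_idealr_closed.

Definition ultraproduct := {ideal_quot null}.
HB.instance Definition _ := GRing.ComNzRing.on ultraproduct.

Definition ultraproj (x : prodfield) : ultraproduct := \pi_({ideal_quot null})%qT x.

Lemma ultraproj_eq x y : reflect (G (fun i => x i = y i)) (ultraproj x == ultraproj y).
Proof.
rewrite /ultraproj -Quotient.idealrBE; apply: (iffP (nullP _)); apply: GS => i.
  by move/eqP; rewrite -[X in X == _]/(x i - y i) subr_eq0 => /eqP.
by move=> xy; rewrite -[LHS]/(x i - y i) xy subrr.
Qed.

Lemma ultraprojK (u : ultraproduct) : ultraproj (repr u) = u.
Proof. exact: reprK. Qed.

Lemma ultraprojB x y : ultraproj (fun i => x i - y i) = ultraproj x - ultraproj y.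
Proof. by rewrite /ultraproj -rmorphB. Qed.

Lemma ultraprojM x y : ultraproj (fun i => x i * y i) = ultraproj x * ultraproj y.
Proof. by rewrite /ultraproj -rmorphM. Qed.

Lemma ultraproj1 : ultraproj (fun=> 1) = 1.
Proof. by rewrite /ultraproj -(rmorph1 (\pi_({ideal_quot null})%qT)). Qed.

Lemma ultraproj0 : ultraproj (fun=> 0) = 0.
Proof. by rewrite /ultraproj -(rmorph0 (\pi_({ideal_quot null})%qT)). Qed.

Definition ultrainv (u : ultraproduct) := ultraproj (fun i => (repr u i)^-1).

(** By the ultrafilter dichotomy, a representative of a nonzero class is nonzero almost
    everywhere. *)
Fact ultra_mulVf u : u != 0 -> ultrainv u * u = 1.
Proof.
move=> u0; rewrite -[X in _ * X]ultraprojK -ultraprojM -ultraproj1; apply/eqP/ultraproj_eq.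
case: (GC (fun i => repr u i = 0)) => [h|]; last by apply: GS => i /eqP; apply: mulVf.
by move: u0; rewrite -[u]ultraprojK -ultraproj0 => /negP[]; apply/ultraproj_eq.
Qed.

Fact ultra_invr0 : ultrainv 0 = 0.
Proof.
have /eqP/ultraproj_eq h : ultraproj (repr (0 : ultraproduct)) = ultraproj (fun=> 0).
  by rewrite ultraprojK ultraproj0.
rewrite -[RHS]ultraproj0; apply/eqP/ultraproj_eq; apply: GS h => i ->.
exact: invr0.
Qed.

HB.instance Definition _ := GRing.ComNzRing_isField.Build ultraproduct ultra_mulVf ultra_invr0.

(** The monic equation is solved in each factor; the chosen roots give a root because sums and
    powers are computed pointwise. *)
Fact ultra_closed : GRing.closed_field_axiom ultraproduct.
Proof.
move=> n P n0.
have rootK i : exists y : K i, y ^+ n = \sum_(j < n) repr (P j) i * y ^+ j.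
  exact: (solve_monicpoly (fun j => repr (P j) i)).
pose y : prodfield := fun i => sval (boolp.cid (rootK i)).
have yX m : ultraproj (fun i => y i ^+ m) = ultraproj y ^+ m.
  elim: m => [|m IHm]; first exact: ultraproj1.
  by rewrite exprS -IHm -ultraprojM; congr ultraproj; apply: prodfield_ext => i; rewrite exprS.
exists (ultraproj y); rewrite -yX.
transitivity (ultraproj (fun i => \sum_(j < n) repr (P j) i * y i ^+ j)).
  congr ultraproj; apply: prodfield_ext => i; rewrite /y; by case: boolp.cid.
elim: n {n0 rootK} y yX => [|n IHn] y yX.
  rewrite big_ord0 -ultraproj0; congr ultraproj; apply: prodfield_ext => i; by rewrite big_ord0.
rewrite big_ord_recr /= -IHn// -yX -[P n]ultraprojK -ultraprojM.
rewrite /ultraproj -rmorphD; congr (_ _); apply: prodfield_ext => i.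
by rewrite big_ord_recr.
Qed.

HB.instance Definition _ := Field_isAlgClosed.Build ultraproduct ultra_closed.

Lemma closed_ultraproduct : exists (F : closedFieldType) (pr : (forall i, K i) -> F),
  [/\ pr (fun=> 1) = 1,
      forall x y, pr (fun i => x i - y i) = pr x - pr y,
      forall x y, pr (fun i => x i * y i) = pr x * pr y &
      forall x y, G (fun i => x i = y i) -> pr x = pr y].
Proof.
exists ultraproduct, ultraproj; split.
- exact: ultraproj1.
- exact: ultraprojB.
- exact: ultraprojM.
- by move=> x y xy; apply/eqP/ultraproj_eq.
Qed.

End Ultraproduct.

(** An element goes to the class of its images in the closures of the subfields generated by s.
    Almost every s contains given x and y, so ring identities can be checked in such subfields. *)
Lemma closed_extension (k : fieldType) :
  exists F : closedFieldType, inhabited {rmorphism k -> F}.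
Proof.
have [G [G0 GI GS GC Gmem]] := cofinal_ultrafilter k.
pose cl (s : seq k) := countable_algebraic_closure (genfield s : countFieldType).
pose K (s : seq k) : closedFieldType := projT1 (cl s).
pose incl (s : seq k) : {rmorphism genfield s -> K s} := projT1 (projT2 (cl s)).
have [F [pr [pr1 prB prM prE]]] := @closed_ultraproduct (seq k) G K G0 GI GS GC.
(* The default 0 occurs only when s does not contain x, which is outside a set of the
   ultrafilter. *)
pose ext (x : k) (s : seq k) : K s := if insub x is Some y then incl s y else 0.
have extE (s : seq k) (y : genfield s) : ext (val y) s = incl s y by rewrite /ext valK.
have lift (s : seq k) x : x \in s -> exists y : genfield s, x = val y.
  by move=> xs; exists (GenField (mem_generated xs)).
have extB : zmod_morphism (fun x => pr (ext x)).
  move=> x y; rewrite -prB; apply: prE.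
  apply: GS (GI _ _ (Gmem x) (Gmem y)) => s [/lift[x' ->] /lift[y' ->]].
  by rewrite -rmorphB !extE rmorphB.
have extM : monoid_morphism (fun x => pr (ext x)).
  split=> [|x y].
    rewrite -pr1; apply: prE; apply: GS (Gmem 0) => s _.
    by rewrite -(rmorph1 (val : genfield s -> k)) extE rmorph1.
  rewrite -prM; apply: prE.
  apply: GS (GI _ _ (Gmem x) (Gmem y)) => s [/lift[x' ->] /lift[y' ->]].
  by rewrite -rmorphM !extE rmorphM.
pose phi : {rmorphism k -> F} := HB.pack (fun x => pr (ext x))
  (GRing.isZmodMorphism.Build _ _ _ extB) (GRing.isMonoidMorphism.Build _ _ _ extM).
by exists F; exact: (inhabits phi).
Qed.

(** * Comparison of the two loci *)

Lemma rmorph_pchar0 (k L : fieldType) (phi : {rmorphism k -> L}) :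
  [pchar k] =i pred0 -> [pchar L] =i pred0.
Proof. by move=> hk p; rewrite (fmorph_pchar phi) hk. Qed.

Theorem corollary1p2 (k : fieldType) (hk : [pchar k] =i pred0) (d e : nat) :
  loci_coincide k d e <-> odd (d + e).
Proof.
split=> [coincide|de_odd K iota P P0].
  (* For d + e even, the zero weight form over a closed extension separates the loci. *)
  apply/negPn/negP => de_even; have [K [iota]] := closed_extension k.
  have dem : (d + e = (d + e)./2.*2)%N by rewrite even_halfK.
  apply: (zero_weight_not_stable hk (phi := iota) dem).
  by apply/coincide; [exact: zero_weight_neq0|exact: zero_weight_semistable].
split=> [[n [s [n0 s_inv sP]]]|[_ [n [s [n0 s_inv sP _]]]]]; last by exists n, s.
(* For d + e odd, the section that witnesses semistability also witnesses stability. *)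
split; first exact: (finite_stabilizer_semistable (rmorph_pchar0 iota hk) de_odd n0 s_inv sP).
exists n, s; split=> // L phi Q Q0 sQ.
exact: (zariski_closed_orbit (rmorph_pchar0 phi hk) de_odd n0 s_inv sQ).
Qed.
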